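(* Let $F$ be an algebraically closed field of characteristic $0$, let $n\ge 2$, let $\mathfrak{J}$ be the anti-Jordan triple system of all $n\times n$ matrices over $F$, and let $\mathfrak{A}=F\langle X\rangle/I$ be its universal associative envelope, with $X=\{e_{i,j}\}_{i,j\in\Omega}$ and $\Omega=\{1,\dots,n\}$. Then: (i) The set $\mathfrak{G}$ (listed explicitly in the context) is a Gröbner basis for the ideal $I$ with respect to the deglex order. (ii) The algebra $\mathfrak{A}$ is finite-dimensional, and a basis of $\mathfrak{A}$ over $F$ is given by (the cosets of) the following $4n^2+1$ monomials: $$\mathfrak{B}=\{1,\ e_{i,j},\ e_{i,1}e_{1,j},\ e_{1,1}^2e_{1,j},\ e_{1,1}^4 \mid i,j\in\Omega\}\cup\{e_{1,i}e_{j,1}\mid i,j\in\Omega,\ (i,j)\ne(1,1)\}\cup\{e_{1,i}e_{1,1}e_{j,1}\mid i,j\in\Omega,\ j\ne 1\}.$$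
   Context: The anti-Jordan triple system $\mathfrak{J}$ is the space of $n\times n$ matrices over $F$ with trilinear product $\langle a,b,c\rangle=abc-cba$; $E_{i,j}$ are the matrix units. $F\langle X\rangle$ is the free unital associative algebra on symbols $X=\{e_{i,j}\}_{i,j\in\Omega}$. $I$ is the two-sided ideal generated by all elements $$e_{i,j}e_{k,\ell}e_{m,t}-e_{m,t}e_{k,\ell}e_{i,j}-\delta_{j,k}\delta_{\ell,m}e_{i,t}+\delta_{t,k}\delta_{\ell,i}e_{m,j}\quad(i,j,k,\ell,m,t\in\Omega),$$ and $\mathfrak{A}=F\langle X\rangle/I$ is the universal associative envelope of $\mathfrak{J}$, with natural map $\mathfrak{J}\to\mathfrak{A}$, $E_{i,j}\mapsto e_{i,j}+I$. Order: $e_{i,j}<e_{k,\ell}$ if $i<k$, or $i=k$ and $j<\ell$; words are compared by deglex (first by degree, then lexicographically from the left). $\mathrm{LM}(f)$ is the largest word occurring in $f$ with nonzero coefficient. A subset $G\subset I$ is a Gröbner basis of $I$ if for every nonzero $f\in I$ there is $g\in G$ such that $\mathrm{LM}(g)$ is a factor (subword) of $\mathrm{LM}(f)$. The set $\mathfrak{G}$ consists of the following elements: - $e_{i,1}e_{1,1}e_{1,j}-e_{1,j}e_{1,1}e_{i,1}-e_{i,j}$ ($i,j\in\Omega\setminus\{1\}$); - $e_{i,j}e_{j,k}-e_{i,1}e_{1,k}$ ($i,j,k\in\Omega$, $k\ne i$, $j\ne1$); - $e_{i,j}e_{k,i}-e_{1,j}e_{k,1}$ ($i,j,k\in\Omega$,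 $j\ne k$, $i\ne1$); - $e_{i,j}e_{k,\ell}$ ($i,j,k,\ell\in\Omega$, $i\ne\ell$, $j\ne k$); - $e_{i,j}e_{j,i}-e_{i,1}e_{1,i}-e_{1,j}e_{j,1}+e_{1,1}^2$ ($i,j\in\Omega\setminus\{1\}$); - $e_{i,1}e_{1,j}e_{j,1}-e_{1,1}^2e_{i,1}-e_{i,1}$ ($i,j\in\Omega$, $i\ne1$, $j\ne i$); - $e_{j,1}e_{1,j}e_{i,1}-e_{1,1}^2e_{i,1}$ ($i,j\in\Omega\setminus\{1\}$, $i\ne j$); - $e_{1,i}e_{i,1}e_{1,j}-e_{1,1}^2e_{1,j}$ ($i,j\in\Omega\setminus\{1\}$, $i\ne j$); - $e_{1,i}e_{j,1}e_{1,j}-e_{1,1}^2e_{1,i}+e_{1,i}$ ($i,j\in\Omega$, $i\ne j$, $i\ne1$); - $e_{i,1}e_{1,i}e_{i,1}-2e_{1,1}^2e_{i,1}-e_{i,1}$ ($i\in\Omega\setminus\{1\}$); - $e_{1,j}e_{j,1}e_{1,j}-2e_{1,1}^2e_{1,j}+e_{1,j}$ ($j\in\Omega\setminus\{1\}$); - $e_{i,1}e_{1,j}e_{k,1}$ ($i,j,k\in\Omega$, $k\ne j$, $i\neq j$); - $e_{1,i}e_{j,1}e_{1,k}$ ($i,j,k\in\Omega$, $i\ne j$, $k\ne j$); - $e_{1,1}e_{1,i}e_{i,1}-\tfrac12e_{1,1}^3-\tfrac12e_{1,1}$ ($i\in\Omega\setminus\{1\}$); - $e_{1,1}e_{i,1}e_{1,i}-\tfrac12e_{1,1}^3+\tfrac12e_{1,1}$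 ($i\in\Omega\setminus\{1\}$); - $e_{1,i}e_{i,1}e_{1,1}-\tfrac12e_{1,1}^3-\tfrac12e_{1,1}$ ($i\in\Omega\setminus\{1\}$); - $e_{i,1}e_{1,i}e_{1,1}-\tfrac12e_{1,1}^3+\tfrac12e_{1,1}$ ($i\in\Omega\setminus\{1\}$); - $e_{1,1}^3e_{1,i}-e_{1,1}e_{1,i}$ ($i\in\Omega\setminus\{1\}$); - $e_{1,1}^3e_{i,1}+e_{1,1}e_{i,1}$ ($i\in\Omega\setminus\{1\}$); - $e_{1,1}^5-e_{1,1}$. *)

(* Defs.v *)
From HB Require Import structures.
From mathcomp Require Import all_boot all_order all_algebra.
From mathcomp Require Import finmap boolp.
From mathcomp Require Import monalg.

Set Implicit Arguments.
Unset Strict Implicit.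
Unset Printing Implicit Defensive.

Import Order.Theory GRing.Theory.
Local Open Scope ring_scope.
Local Open Scope quotient_scope.

(* The two-sided ideal generated by S; closure under opposites follows from
   multiplication by -1. *)
Inductive ideal_gen (R : nzRingType) (S : R -> Prop) : R -> Prop :=
| ideal_gen_base x : S x -> ideal_gen S x
| ideal_gen0 : ideal_gen S 0
| ideal_genD x y : ideal_gen S x -> ideal_gen S y -> ideal_gen S (x + y)
| ideal_genMl a x : ideal_gen S x -> ideal_gen S (a * x)
| ideal_genMr a x : ideal_gen S x -> ideal_gen S (x * a).

Definition is_basis (F : fieldType) (V : lmodType F) (s : seq V) : Prop :=
  (forall c : 'I_(size s) -> F,
     \sum_(i < size s) c i *: s`_i = 0 -> forall i, c i = 0) /\
  (forall v : V, exists c : 'I_(size s) -> F,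
     v = \sum_(i < size s) c i *: s`_i).

Definition finite_dimensional (F : fieldType) (V : lmodType F) : Prop :=
  exists d : nat, inhabited (Vector.axiom d V).

Section TripleProduct.
Variables (F : fieldType) (n : nat).
Implicit Types a b c : 'M[F]_n.

(* The anti-Jordan triple product on n x n matrices. *)
Definition ajts a b c : 'M[F]_n := a *m b *m c - c *m b *m a.

Definition delta (i j : 'I_n) : F := (i == j)%:R.

Variables (A : algType F) (E : 'I_n -> 'I_n -> A).

(* The linear map sending the matrix unit E_ij to E i j. *)
Definition lin_ext a : A := \sum_i \sum_j a i j *: E i j.

Lemma lin_extE a :
  lin_ext a = \sum_(p : 'I_n * 'I_n) a p.1 p.2 *: E p.1 p.2.
Proof. by rewrite /lin_ext pair_bigA. Qed.

Lemma lin_ext_is_linear : linear lin_ext.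
Proof.
move=> c a b; rewrite !lin_extE scaler_sumr -big_split /=.
by apply: eq_bigr => p _; rewrite !mxE scalerDl scalerA.
Qed.

HB.instance Definition _ :=
  GRing.isLinear.Build F 'M[F]_n A _ lin_ext lin_ext_is_linear.

Lemma lin_ext_mul3 a b c :
  lin_ext a * lin_ext b * lin_ext c =
  \sum_(p : 'I_n * 'I_n) \sum_(q : 'I_n * 'I_n) \sum_(r : 'I_n * 'I_n)
    (a p.1 p.2 * b q.1 q.2 * c r.1 r.2) *:
      (E p.1 p.2 * E q.1 q.2 * E r.1 r.2).
Proof.
rewrite !lin_extE -mulrA mulr_suml; apply: eq_bigr => p _.
rewrite mulr_suml mulr_sumr; apply: eq_bigr => q _.
rewrite !mulr_sumr; apply: eq_bigr => r _.
by rewrite -!scalerAl -!scalerAr !scalerA !mulrA.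
Qed.

Lemma lin_ext_mulmx3 a b c :
  lin_ext (a *m b *m c) =
  \sum_(p : 'I_n * 'I_n) \sum_(q : 'I_n * 'I_n) \sum_(r : 'I_n * 'I_n)
    (a p.1 p.2 * b q.1 q.2 * c r.1 r.2) *:
      ((delta p.2 q.1 * delta q.2 r.1) *: E p.1 r.2).
Proof.
have sum_delta (V : lmodType F) (i : 'I_n) (f : 'I_n -> V) :
    \sum_j delta i j *: f j = f i.
  rewrite (bigD1 i) //= /delta eqxx scale1r big1 ?addr0 // => j ji.
  by rewrite eq_sym (negbTE ji) scale0r.
rewrite -(pair_bigA _ (fun i j => \sum_q \sum_r (a i j * b q.1 q.2 * c r.1 r.2)
   *: ((delta j q.1 * delta q.2 r.1) *: E i r.2))) /=.
apply: eq_bigr => i _; under [LHS]eq_bigr => t _.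
  rewrite mxE scaler_suml.
  under eq_bigr => l _ do rewrite mxE mulr_suml scaler_suml.
  rewrite exchange_big /=; over.
rewrite exchange_big /=; apply: eq_bigr => j _.
rewrite -(pair_bigA _ (fun k l => \sum_r (a i j * b k l * c r.1 r.2)
   *: ((delta j k * delta l r.1) *: E i r.2))) /=.
under [RHS]eq_bigr => k _.
  have -> : \sum_l \sum_r (a i j * b k l * c r.1 r.2)
     *: ((delta j k * delta l r.1) *: E i r.2) =
     delta j k *: \sum_l \sum_r (a i j * b k l * c r.1 r.2)
     *: (delta l r.1 *: E i r.2).
    rewrite scaler_sumr; apply: eq_bigr => l _.
    rewrite scaler_sumr; apply: eq_bigr => r _.
    by rewrite !scalerA mulrCA mulrA.
  over.
rewrite sum_delta exchange_big; apply: eq_bigr => l _.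
rewrite -(pair_bigA _ (fun m t => (a i j * b j l * c m t)
   *: (delta l m *: E i t))) /=.
under [RHS]eq_bigr => m _.
  have -> : \sum_t (a i j * b j l * c m t) *: (delta l m *: E i t) =
    delta l m *: \sum_t (a i j * b j l * c m t) *: E i t.
    rewrite scaler_sumr; apply: eq_bigr => t _.
    by rewrite !scalerA mulrC.
  over.
by rewrite sum_delta.
Qed.

Hypothesis E_rel : forall i j k l m t,
  E i j * E k l * E m t - E m t * E k l * E i j =
  (delta j k * delta l m) *: E i t - (delta t k * delta l i) *: E m j.

Lemma lin_ext_ajts a b c :
  lin_ext (ajts a b c) =
  lin_ext a * lin_ext b * lin_ext c
  - lin_ext c * lin_ext b * lin_ext a.
Proof.
have exch (V : zmodType) (f : 'I_n * 'I_n -> 'I_n * 'I_n -> 'I_n * 'I_n -> V) :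
    \sum_r \sum_q \sum_p f p q r = \sum_p \sum_q \sum_r f p q r.
  rewrite exchange_big /=; under eq_bigr => q _ do rewrite exchange_big /=.
  by rewrite exchange_big.
rewrite /ajts raddfB /= !lin_ext_mulmx3 !lin_ext_mul3.
rewrite -[X in _ - X = _]exch -[X in _ = _ - X]exch -!sumrB.
apply: eq_bigr => p _; rewrite -!sumrB; apply: eq_bigr => q _.
rewrite -!sumrB; apply: eq_bigr => r _.
have -> : c r.1 r.2 * b q.1 q.2 * a p.1 p.2 = a p.1 p.2 * b q.1 q.2 * c r.1 r.2.
  by rewrite mulrC mulrA mulrAC.
by rewrite -!scalerBr E_rel.
Qed.

End TripleProduct.

Arguments delta {F n} i j.

Definition word (n : nat) := {fmonom ('I_n * 'I_n)%type}.

Definition free_alg (F : fieldType) (n : nat) := {malg F[word n]}.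

(* Non-strict order. On words of equal size the library order on sequences is
   the lexicographic order from the left; letters e_ij are compared as pairs. *)
Definition deglex (n : nat) (u v : word n) : bool :=
  (size u < size v)%N ||
  ((size u == size v) &&
   (((u : seq _) : seqlexi ('I_n *l 'I_n)%type) <= (v : seq _))%O).

Section FreeAlgebra.
Variables (F : fieldType) (n : nat).
Implicit Types (f : free_alg F n) (w : word n).

Definition e_ (i j : 'I_n) : free_alg F n := << fmu (i, j) >>.

(* A relation rather than a function: 0 has no leading monomial. *)
Definition is_LM f w : Prop :=
  w \in msupp f /\ forall v, v \in msupp f -> deglex v w.

Definition groebner_basis (J G : free_alg F n -> Prop) : Prop :=
  (forall g, G g -> J g) /\
  (forall f, J f -> f != 0 ->
     exists g u v, [/\ G g, is_LM g u, is_LM f v & infix u v]).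

Definition relator (i j k l m t : 'I_n) : free_alg F n :=
  e_ i j * e_ k l * e_ m t - e_ m t * e_ k l * e_ i j
  - (delta j k * delta l m) *: e_ i t + (delta t k * delta l i) *: e_ m j.

Definition env_ideal : free_alg F n -> Prop :=
  ideal_gen (fun f => exists i j k l m t, f = relator i j k l m t).

Definition env_idealb : {pred free_alg F n} := fun f => `[< env_ideal f >].

Lemma env_idealP f : reflect (env_ideal f) (f \in env_idealb).
Proof. exact: asboolP. Qed.

Lemma env_ideal_zmod : zmod_closed env_idealb.
Proof.
split; first by apply/env_idealP; exact: ideal_gen0.
move=> x y /env_idealP xI /env_idealP yI; apply/env_idealP.
by apply: ideal_genD => //; rewrite -mulN1r; apply: ideal_genMl.
Qed.

HB.instance Definition _ :=
  GRing.isZmodClosed.Build (free_alg F n) env_idealb env_ideal_zmod.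

Lemma env_idealMl a f : f \in env_idealb -> a * f \in env_idealb.
Proof. by move=> /env_idealP fI; apply/env_idealP; apply: ideal_genMl. Qed.

Lemma env_idealMr a f : f \in env_idealb -> f * a \in env_idealb.
Proof. by move=> /env_idealP fI; apply/env_idealP; apply: ideal_genMr. Qed.

Lemma env_idealZ c f : f \in env_idealb -> c *: f \in env_idealb.
Proof. by move=> fI; rewrite -[f]mul1r scalerAl; apply: env_idealMl. Qed.

Lemma e_const i j : mcoeff mone (e_ i j) = 0.
Proof. by rewrite /e_ mcoeffU fm1_eq1. Qed.

Lemma env_ideal1 : 1 \notin env_idealb.
Proof.
suff H f : env_ideal f -> mcoeff mone f = 0.
  by apply/negP => /env_idealP /H /eqP; rewrite rmorph1 oner_eq0.
elim=> [x [i [j [k [l [m [t ->]]]]]]| |g h _ g0 _ h0|a g _ g0|a g _ g0].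
- rewrite /relator mcoeffD !mcoeffB.
  rewrite [X in _ - X + _]mcoeffZ [X in _ + X]mcoeffZ.
  rewrite [X in _ - _ * X + _]e_const [X in _ + _ * X]e_const !mulr0 subr0 addr0.
  rewrite [X in X - _]rmorphM [X in _ - X]rmorphM /= !e_const.
  by rewrite [X in X - _]mulr0 [X in _ - X]mulr0 subr0.
- exact: raddf0.
- by rewrite mcoeffD g0 h0 addr0.
- by rewrite rmorphM /= g0 mulr0.
- by rewrite rmorphM /= g0 mul0r.
Qed.

Lemma free_alg_scalerAr (c : F) (f g : free_alg F n) :
  c *: (f * g) = f * (c *: g).
Proof.
apply/malgP => k; rewrite [LHS]mcoeffZ [X in _ * X]mcoeffMl.
rewrite (mcoeffMlw _ (fsubset_refl _) (msuppZ_le c g)) mulr_sumr.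
apply: eq_bigr => u _; rewrite mulr_sumr; apply: eq_bigr => v _.
by rewrite mcoeffZ mulrnAr mulrCA.
Qed.

Definition envelope : Type := Quotient.quot env_idealb.

HB.instance Definition _ := Choice.on envelope.
HB.instance Definition _ := GRing.Zmodule.on envelope.

Definition coset (f : free_alg F n) : envelope := \pi_(Quotient.quot env_idealb) f.

Definition env_one : envelope := coset 1.
Definition env_mul (x y : envelope) : envelope := coset (repr x * repr y).
Definition env_scale (c : F) (x : envelope) : envelope := coset (c *: repr x).

Lemma coset_eq f g : (coset f == coset g) = (f - g \in env_idealb).
Proof. by rewrite Quotient.idealrBE. Qed.

Lemma coset_surj (x : envelope) : x = coset (repr x).
Proof. by rewrite /coset reprK. Qed.

Lemma coset_repr f : repr (coset f) - f \in env_idealb.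
Proof. by rewrite -coset_eq -coset_surj. Qed.

Lemma coset_is_zmod_morphism : zmod_morphism coset.
Proof. exact: (@pi_is_zmod_morphism _ _ _ (Quotient.quot env_idealb)). Qed.

HB.instance Definition _ :=
  GRing.isZmodMorphism.Build (free_alg F n) envelope coset
    coset_is_zmod_morphism.

Lemma cosetM f g : env_mul (coset f) (coset g) = coset (f * g).
Proof.
apply/eqP; rewrite coset_eq.
have -> : repr (coset f) * repr (coset g) - f * g =
          repr (coset f) * (repr (coset g) - g) + (repr (coset f) - f) * g.
  by rewrite mulrBr mulrBl addrA subrK.
by apply: rpredD; [apply: env_idealMl|apply: env_idealMr]; apply: coset_repr.
Qed.

Lemma cosetZ c f : env_scale c (coset f) = coset (c *: f).
Proof.
by apply/eqP; rewrite coset_eq -scalerBr env_idealZ ?coset_repr.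
Qed.

Lemma env_mulA : associative env_mul.
Proof.
move=> x y z; rewrite (coset_surj x) (coset_surj y) (coset_surj z).
by rewrite !cosetM mulrA.
Qed.

Lemma env_mul1l : left_id env_one env_mul.
Proof. by move=> x; rewrite (coset_surj x) cosetM mul1r. Qed.

Lemma env_mul1r : right_id env_one env_mul.
Proof. by move=> x; rewrite (coset_surj x) cosetM mulr1. Qed.

Lemma env_mulDl : left_distributive env_mul +%R.
Proof.
move=> x y z; rewrite (coset_surj x) (coset_surj y) (coset_surj z).
by rewrite -raddfD !cosetM mulrDl raddfD.
Qed.

Lemma env_mulDr : right_distributive env_mul +%R.
Proof.
move=> x y z; rewrite (coset_surj x) (coset_surj y) (coset_surj z).
by rewrite -raddfD !cosetM mulrDr raddfD.
Qed.

Lemma env_one_neq0 : env_one != 0.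
Proof. by rewrite -(raddf0 coset) coset_eq subr0 env_ideal1. Qed.

HB.instance Definition _ := GRing.Zmodule_isNzRing.Build envelope
  env_mulA env_mul1l env_mul1r env_mulDl env_mulDr env_one_neq0.

Lemma env_scaleA a b x : env_scale a (env_scale b x) = env_scale (a * b) x.
Proof. by rewrite (coset_surj x) !cosetZ scalerA. Qed.

Lemma env_scale1 : left_id 1 env_scale.
Proof. by move=> x; rewrite (coset_surj x) cosetZ scale1r. Qed.

Lemma env_scaleDr : right_distributive env_scale +%R.
Proof.
move=> c x y; rewrite (coset_surj x) (coset_surj y).
by rewrite -raddfD !cosetZ scalerDr raddfD.
Qed.

Lemma env_scaleDl x : {morph env_scale^~ x : a b / a + b}.
Proof.
by move=> a b; rewrite (coset_surj x) !cosetZ scalerDl raddfD.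
Qed.

HB.instance Definition _ := GRing.Zmodule_isLmodule.Build F envelope
  env_scaleA env_scale1 env_scaleDr env_scaleDl.

Lemma env_scaleAl (c : F) (x y : envelope) : c *: (x * y) = (c *: x) * y.
Proof.
rewrite (coset_surj x) (coset_surj y).
by rewrite [LHS](congr1 (env_scale c) (cosetM _ _)) cosetZ scalerAl -cosetM
           -cosetZ.
Qed.

HB.instance Definition _ :=
  GRing.Lmodule_isLalgebra.Build F envelope env_scaleAl.

Lemma env_scaleAr (c : F) (x y : envelope) : c *: (x * y) = x * (c *: y).
Proof.
rewrite (coset_surj x) (coset_surj y).
by rewrite [LHS](congr1 (env_scale c) (cosetM _ _)) cosetZ free_alg_scalerAr
           -cosetM -cosetZ.
Qed.

HB.instance Definition _ :=
  GRing.Lalgebra_isAlgebra.Build F envelope env_scaleAr.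

Lemma coset_is_monoid_morphism : monoid_morphism coset.
Proof.
by split=> [|f g]; [exact: (erefl env_one) | exact: (esym (cosetM f g))].
Qed.

HB.instance Definition _ :=
  GRing.isMonoidMorphism.Build (free_alg F n) envelope coset
    coset_is_monoid_morphism.

Lemma coset_is_scalable : scalable coset.
Proof. by move=> c f; rewrite -cosetZ. Qed.

HB.instance Definition _ :=
  GRing.isScalable.Build F (free_alg F n) envelope _ coset coset_is_scalable.

(* The natural map of the triple system into its envelope, E_ij |-> e_ij + I. *)
Definition natural_map (a : 'M[F]_n) : envelope :=
  lin_ext (fun i j => coset (e_ i j)) a.

Lemma coset_relator i j k l m t :
  coset (e_ i j) * coset (e_ k l) * coset (e_ m t)
  - coset (e_ m t) * coset (e_ k l) * coset (e_ i j) =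
  (delta j k * delta l m) *: coset (e_ i t)
  - (delta t k * delta l i) *: coset (e_ m j).
Proof.
have H : coset (relator i j k l m t) = 0.
  apply/eqP; rewrite -(raddf0 coset) coset_eq subr0.
  by apply/env_idealP; apply: ideal_gen_base; exists i, j, k, l, m, t.
have cE (A B : lalgType F) (phi : {lrmorphism A -> B}) p q r u v (c d : F) :
    phi (p * q * r - r * q * p - c *: u + d *: v) =
    phi p * phi q * phi r - phi r * phi q * phi p - c *: phi u + d *: phi v.
  by rewrite raddfD !raddfB /= !linearZ !rmorphM.
move: H; rewrite /relator (cE _ _ coset) => /(canRL (addrK _)); rewrite sub0r.
by move=> /(canRL (subrK _)) ->; rewrite addrC.
Qed.

Lemma natural_map_ajts a b c :
  natural_map (ajts a b c) =
  natural_map a * natural_map b * natural_map c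
  - natural_map c * natural_map b * natural_map a.
Proof.
exact: (@lin_ext_ajts F n envelope (fun i j => coset (e_ i j)) coset_relator).
Qed.

End FreeAlgebra.

Arguments is_LM {F n}.
Arguments groebner_basis {F n}.

(* The index 1 of Omega = {1, ..., n}; 'I_n is numbered from 0. *)
Definition idx1 (n : nat) (hn : (2 <= n)%N) : 'I_n := Ordinal (ltnW hn).

Section GroebnerBasis.
Variables (F : fieldType) (n : nat) (hn : (2 <= n)%N).
Local Notation e := (@e_ F n).
Local Notation o := (idx1 hn).

Inductive frakG : free_alg F n -> Prop :=
| frakG_1 i j : i != o -> j != o ->
    frakG (e i o * e o o * e o j - e o j * e o o * e i o - e i j)
| frakG_2 i j k : k != i -> j != o ->
    frakG (e i j * e j k - e i o * e o k)
| frakG_3 i j k : j != k -> i != o ->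
    frakG (e i j * e k i - e o j * e k o)
| frakG_4 i j k l : i != l -> j != k ->
    frakG (e i j * e k l)
| frakG_5 i j : i != o -> j != o ->
    frakG (e i j * e j i - e i o * e o i - e o j * e j o + e o o ^+ 2)
| frakG_6 i j : i != o -> j != i ->
    frakG (e i o * e o j * e j o - e o o ^+ 2 * e i o - e i o)
| frakG_7 i j : i != o -> j != o -> i != j ->
    frakG (e j o * e o j * e i o - e o o ^+ 2 * e i o)
| frakG_8 i j : i != o -> j != o -> i != j ->
    frakG (e o i * e i o * e o j - e o o ^+ 2 * e o j)
| frakG_9 i j : i != j -> i != o ->
    frakG (e o i * e j o * e o j - e o o ^+ 2 * e o i + e o i)
| frakG_10 i : i != o ->
    frakG (e i o * e o i * e i o - 2 *: (e o o ^+ 2 * e i o) - e i o)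
| frakG_11 j : j != o ->
    frakG (e o j * e j o * e o j - 2 *: (e o o ^+ 2 * e o j) + e o j)
| frakG_12 i j k : k != j -> i != j ->
    frakG (e i o * e o j * e k o)
| frakG_13 i j k : i != j -> k != j ->
    frakG (e o i * e j o * e o k)
| frakG_14 i : i != o ->
    frakG (e o o * e o i * e i o - 2^-1 *: e o o ^+ 3 - 2^-1 *: e o o)
| frakG_15 i : i != o ->
    frakG (e o o * e i o * e o i - 2^-1 *: e o o ^+ 3 + 2^-1 *: e o o)
| frakG_16 i : i != o ->
    frakG (e o i * e i o * e o o - 2^-1 *: e o o ^+ 3 - 2^-1 *: e o o)
| frakG_17 i : i != o ->
    frakG (e i o * e o i * e o o - 2^-1 *: e o o ^+ 3 + 2^-1 *: e o o)
| frakG_18 i : i != o ->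
    frakG (e o o ^+ 3 * e o i - e o o * e o i)
| frakG_19 i : i != o ->
    frakG (e o o ^+ 3 * e i o + e o o * e i o)
| frakG_20 :
    frakG (e o o ^+ 5 - e o o).

Local Notation Omega := (enum 'I_n).

Definition frakB : seq (free_alg F n) :=
  [:: 1]
  ++ [seq e i j | i <- Omega, j <- Omega]
  ++ [seq e i o * e o j | i <- Omega, j <- Omega]
  ++ [seq e o o ^+ 2 * e o j | j <- Omega]
  ++ [:: e o o ^+ 4]
  ++ [seq e o p.1 * e p.2 o | p <- enum {: 'I_n * 'I_n} & p != (o, o)]
  ++ [seq e o p.1 * e o o * e p.2 o | p <- enum {: 'I_n * 'I_n} & p.2 != o].

End GroebnerBasis.

(* Main.v *)
Require Import Defs.
From HB Require Import structures.
From mathcomp Require Import all_boot all_order all_algebra.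
From mathcomp Require Import finmap boolp monalg zify ring.

Set Implicit Arguments.
Unset Strict Implicit.
Unset Printing Implicit Defensive.

Import Order.Theory GRing.Theory.
Local Open Scope ring_scope.

(** Write A for the envelope and R for the set of words that avoid the leading
    monomials of frakG; these are the words of frakB.  They span A because frakG
    lies in the ideal, and they are free in A because A has enough matrix
    representations.  Both parts of the theorem follow from these two facts.

    Membership of frakG in the ideal is a computation in an arbitrary algebra
    with elements E_ij subject to the triple relations.  Reversing a product of
    four letters by exchanging the outer letters of its triples can be done in
    two orders, and the comparison (exchange4) gives relations in degree two:
    E_ij E_kl vanishes unless j = k or i = l, and if exactly one of these holds,
    the common index does not matter (prod_eq0, prod_indep, prod_diag).  The
    relations of higher degree follow from these and from the triple relations.
    Replacing E_ij by E_ji changes the sign of the right-hand side of the triple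
    relations; carrying that sign along halves the number of computations.

    Since every word outside R contains a leading monomial of frakG and deglex
    is a multiplicative well-order, each element of the free algebra is
    congruent to a combination of words of R that do not exceed its own words.
    So R spans A (exists_normal_form).

    Freeness is normal_words_free.  The maps a |-> l a with l^2 = 1,
    a |-> l a^T with l^2 = -1, and a |-> 0 respect the triple product, so the
    five homomorphisms from the free algebra to matrices that they define kill
    the ideal.  Reading the matrix entries of the images of a combination of
    the 4n^2+1 words of R, with the even and odd parts in l separated, forces
    all its coefficients to vanish.

    Finally, if the leading monomial of an element of the ideal were in R,
    reducing its tail would give a nonzero combination of words of R in the
    ideal, contrary to freeness: this is the Groebner basis property
    (normal_words_groebner). *)

(** * Triple relations and their consequences *)

(** With the trivial sign these are the defining relations of the envelope.
    The other sign is the one satisfied by the transposed family. *)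
Definition triple_rel (F : fieldType) (A : algType F) (n : nat) (s : bool)
    (E : 'I_n -> 'I_n -> A) : Prop :=
  forall i j k l m t,
    E i j * E k l * E m t - E m t * E k l * E i j =
    (-1) ^+ s *: (((j == k) && (l == m))%:R *: E i t
                  - ((t == k) && (l == i))%:R *: E m j).

(** This symmetry turns each relation proved below into its transposed one. *)
Lemma triple_rel_tr (F : fieldType) (A : algType F) (n : nat) (s : bool)
    (E : 'I_n -> 'I_n -> A) :
  triple_rel s E -> triple_rel (~~ s) (fun i j => E j i).
Proof.
move=> H i j k l m t; rewrite (H j i l k t m) signrN scaleNr -scalerN opprB.
rewrite [l == m]eq_sym [l == i]eq_sym [t == k]eq_sym [j == k]eq_sym.
by rewrite !(andbC (_ == _) (k == _)).
Qed.

Section Relations.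
Variables (F : fieldType) (A : algType F) (n : nat) (o : 'I_n).
Hypothesis charF : [pchar F] =i pred0.

Lemma mulrn_inj k (x y : A) : x *+ k.+1 = y *+ k.+1 -> x = y.
Proof.
rewrite -!(scaler_nat k.+1); apply: scalerI.
by rewrite ((pcharf0P F).1 charF).
Qed.

Implicit Types (E : 'I_n -> 'I_n -> A) (s : bool).

(** A product abcd becomes cdab by exchanging a with c and b with d, in either
    order.  Comparing the two results gives relations of degree two: products
    of four letters cancel, and what remains are the lower terms. *)
Lemma exchange4 s E (H : triple_rel s E) i1 j1 i2 j2 i3 j3 i4 j4 :
  (((j1 == i2) && (j2 == i3))%:R *: E i1 j3
     - ((j3 == i2) && (j2 == i1))%:R *: E i3 j1) * E i4 j4
  + E i3 j3 * (((j2 == i1) && (j1 == i4))%:R *: E i2 j4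
     - ((j4 == i1) && (j1 == i2))%:R *: E i4 j2)
  = (((j1 == i4) && (j4 == i3))%:R *: E i1 j3
     - ((j3 == i4) && (j4 == i1))%:R *: E i3 j1) * E i2 j2
  + E i1 j1 * (((j2 == i3) && (j3 == i4))%:R *: E i2 j4
     - ((j4 == i3) && (j3 == i2))%:R *: E i4 j2).
Proof.
have exch (a b c d : A) :
    (a * b * c - c * b * a) * d + c * (b * a * d - d * a * b)
    = (a * d * c - c * d * a) * b + a * (b * c * d - d * c * b).
  rewrite !mulrBl !mulrBr !mulrA [LHS]addrA subrK [RHS]addrC.
  by rewrite addrA subrK.
move: (exch (E i1 j1) (E i2 j2) (E i3 j3) (E i4 j4)); rewrite !H.
rewrite -!scalerAl -!scalerAr -!scalerDr => /scalerI.
by apply; rewrite signr_eq0.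
Qed.

Ltac simpl_deltas :=
  rewrite ?eqxx;
  repeat match goal with
  | H : is_true (?x != ?y) |- context [?x == ?y] => rewrite (negPf H)
  | H : is_true (?x != ?y) |- context [?y == ?x] =>
      rewrite [y == x]eq_sym (negPf H)
  end;
  rewrite ?andbF ?andbT /= ?scale0r ?scale1r ?subr0 ?sub0r ?subrr
    ?mul0r ?mulr0 ?addr0 ?add0r.

(** Apply the exchange to E_ik E_ki E_ij E_kl: the product E_ij E_kl turns out
    to be its own opposite. *)
Lemma prod_eq0 s E (H : triple_rel s E) i j k l :
  i != l -> j != k -> E i j * E k l = 0.
Proof.
move=> il jk; have := exchange4 H i k k i i j k l.
simpl_deltas; rewrite -mulr2n => H2.
by apply: (@mulrn_inj 1); rewrite H2 mul0rn.
Qed.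

(** The middle index is moved by the exchange of E_il E_ll E_lj E_jk. *)
Lemma prod_indep s E (H : triple_rel s E) i k j l :
  i != k -> E i j * E j k = E i l * E l k.
Proof.
move=> ik; have [-> //|jl] := eqVneq j l.
by have := exchange4 H i l l l l j j k; simpl_deltas.
Qed.

Lemma prod_indep_tr s E (H : triple_rel s E) j k i l :
  j != k -> E i j * E k i = E l j * E k l.
Proof. exact: (prod_indep (triple_rel_tr H) i l). Qed.

(** The exchange of E_io E_oo E_oj E_ji; in matrices, E_ij E_ji splits into a
    part that depends on i and a part that depends on j. *)
Lemma prod_diag s E (H : triple_rel s E) i j :
  E i j * E j i = E i o * E o i + E o j * E j o - E o o * E o o.
Proof.
have [->|io] := eqVneq i o; first by rewrite addrC addKr.
have [->|jo] := eqVneq j o; first by rewrite addrK.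
have := exchange4 H i o o o o j j i; simpl_deltas.
by rewrite mulNr mulrN => /(canRL (subrK _)) ->; rewrite -addrA addrC.
Qed.

(** The middle index of E_io E_oj can be moved away from o, and then the last
    two factors do not chain. *)
Lemma cube_eq0 s E (H : triple_rel s E) i j k :
  i != j -> k != j -> E i o * E o j * E k o = 0.
Proof.
move=> ij kj; have [jo|jo] := eqVneq j o.
  subst j; rewrite (prod_indep H o i) // -mulrA (prod_eq0 H) ?mulr0 //.
  by rewrite eq_sym.
by rewrite (prod_indep H o j) // -mulrA (prod_eq0 H) ?mulr0 // eq_sym.
Qed.

(** Three moves of the index shared by two adjacent factors. *)
Lemma cube_sorted s E (H : triple_rel s E) i j : i != o -> i != j ->
  E j o * E o j * E i o = E o o * E o o * E i o.
Proof.
move=> io ij; have [-> //|jo] := eqVneq j o.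
rewrite -mulrA (prod_indep_tr H o j) 1?eq_sym // mulrA.
rewrite (prod_indep_tr H j o) 1?eq_sym // -mulrA.
by rewrite (prod_indep_tr H j o) 1?eq_sym // mulrA.
Qed.

Lemma cube_unsorted s E (H : triple_rel s E) i j : i != o -> j != i ->
  E i o * E o j * E j o = E o o * E o o * E i o + (-1) ^+ s *: E i o.
Proof.
move=> io ji; have := H i o o j j o; simpl_deltas.
by move/(canRL (subrK _)) ->; rewrite (cube_sorted H) // 1?eq_sym // addrC.
Qed.

(** Rewrite E_io E_oi by prod_diag: then E_oi E_io E_io vanishes, and
    E_ii E_ii E_io can be reversed by a triple relation. *)
Lemma cube_diag s E (H : triple_rel s E) i : i != o ->
  E i o * E o i * E i o =
  (E o o * E o o * E i o) *+ 2 + (-1) ^+ s *: E i o.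
Proof.
move=> io; have := prod_diag H i i.
move/esym/(canRL (subrK _))/(canRL (addrK _)) ->.
rewrite mulrBl mulrDl -[E o i * _ * _]mulrA.
rewrite [E i o * E i o](prod_eq0 H) // 1?eq_sym //.
rewrite mulr0 subr0; have := H i i i i i o; simpl_deltas.
move/(canRL (subrK _)) ->; rewrite (prod_indep_tr H i o) 1?eq_sym //.
rewrite -[E o o * E i o * _]mulrA (prod_indep_tr H i o) 1?eq_sym //.
by rewrite mulrA -addrA addrC mulr2n.
Qed.

Lemma corner_comm s E (H : triple_rel s E) i : i != o ->
  E o o * E o i * E i o = E o i * E i o * E o o.
Proof.
move=> io; rewrite -[RHS]mulrA [E i o * E o o](prod_indep H o i) // mulrA.
by rewrite [E o i * E i i](prod_indep H i o) // eq_sym.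
Qed.

(** The four cubes made of E_oo, E_oi and E_io with E_oo at one end satisfy
    linear relations of rank three (two triple relations, and prod_diag times
    E_oo on either side, where E_ii E_ii E_oo vanishes); corner_comm is the
    missing one. *)
Lemma corner_half s E (H : triple_rel s E) i : i != o ->
  (E o o * E o i * E i o) *+ 2 = E o o * E o o * E o o + (-1) ^+ s *: E o o.
Proof.
move=> io; have := H o o o i i o; simpl_deltas.
have : E i i * E i i * E o o = 0 by rewrite -mulrA (prod_eq0 H) ?mulr0.
rewrite (prod_diag H) mulrBl mulrDl -(corner_comm H) //.
move=> /eqP; rewrite subr_eq add0r => /eqP <- <-.
by rewrite addrC addrA subrK mulr2n.
Qed.

(** Multiply corner_half by E_oi and expand the left-hand side by the transposed
    cube_diag: three times the claim remains. *)
Lemma corner_cube s E (H : triple_rel s E) i : i != o ->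
  E o o * E o o * E o o * E o i = (-1) ^+ s *: (E o o * E o i).
Proof.
move=> io; apply: (@mulrn_inj 2).
have := congr1 (fun x => x * E o i) (corner_half H io).
rewrite /= mulrnAl mulrDl -scalerAl -!mulrA [E o i * (_ * _)]mulrA.
rewrite (cube_diag (triple_rel_tr H) io) signrN scaleNr.
rewrite mulrBr mulrnAr -scalerAr -!mulrA.
move: (E o o * (E o o * (E o o * _))) ((-1) ^+ s *: _) => x y /eqP.
rewrite mulrnBl -mulrnA -subr_eq0 [- (x + y)]opprD addrACA -opprD -mulrSr.
by rewrite (mulrSr x 3) addrK subr_eq0 => /eqP.
Qed.

(** Multiply corner_cube by E_io and apply corner_half on both sides. *)
Lemma corner_fifth s E (H : triple_rel s E) i : i != o ->
  E o o * E o o * E o o * E o o * E o o = E o o.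
Proof.
move=> io; have : E o o * E o o * (E o o * E o i * E i o *+ 2)
    = (-1) ^+ s *: (E o o * E o i * E i o *+ 2).
  by rewrite mulrnAr !mulrA (corner_cube H io) -scalerAl scalerMnr.
rewrite (corner_half H io) mulrDr scalerDr scalerA -signr_addb addbb scale1r.
by rewrite -scalerAr !mulrA addrC => /addrI.
Qed.

End Relations.

(** * The generators frakG lie in the ideal *)

Section Expressions.
Variables (F : fieldType) (n : nat) (A : algType F).
Variable phi : {lrmorphism free_alg F n -> A}.

Lemma eval_mul f g x y : phi f = x -> phi g = y -> phi (f * g) = x * y.
Proof. by move=> <- <-; exact: rmorphM. Qed.

Lemma eval_add f g x y : phi f = x -> phi g = y -> phi (f + g) = x + y.
Proof. by move=> <- <-; exact: raddfD. Qed.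

Lemma eval_opp f x : phi f = x -> phi (- f) = - x.
Proof. by move=> <-; exact: raddfN. Qed.

Lemma eval_scale a f x : phi f = x -> phi (a *: f) = a *: x.
Proof. by move=> <-; exact: linearZ. Qed.

Lemma eval_exp k f x : phi f = x -> phi (f ^+ k) = x ^+ k.
Proof. by move=> <-; exact: rmorphXn. Qed.

End Expressions.

(** Builds a proof that a morphism sends the expression f in the letters to the
    same expression in their images, where EE gives the image of a letter.
    Following the syntax of f avoids unfolding products in the free algebra. *)
Ltac eval_proof EE f :=
  lazymatch f with
  | ?a + ?b =>
      let pa := eval_proof EE a in let pb := eval_proof EE b in
      constr:(eval_add pa pb)
  | ?a * ?b =>
      let pa := eval_proof EE a in let pb := eval_proof EE b in
      constr:(eval_mul pa pb)
  | - ?a => let pa := eval_proof EE a in constr:(eval_opp pa)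
  | ?k *: ?a => let pa := eval_proof EE a in constr:(eval_scale k pa)
  | ?a ^+ ?k => let pa := eval_proof EE a in constr:(eval_exp k pa)
  | e_ _ ?i ?j => constr:(EE i j)
  end.

Section Vanishing.
Variables (F : fieldType) (n : nat) (A : algType F).
Variable phi : {lrmorphism free_alg F n -> A}.
Hypothesis charF : [pchar F] =i pred0.

Lemma half_mulrn2 (V : lmodType F) (x y : V) : x *+ 2 = y -> x = 2^-1 *: y.
Proof.
move=> <-; rewrite -scaler_nat scalerA mulVf ?scale1r //.
by rewrite ((pcharf0P F).1 charF).
Qed.

Variable hn : (2 <= n)%N.
Local Notation o := (idx1 hn).

(** Stated for an abstract target so that the letters become variables subject
    to the triple relations only.  Transposition pairs most of the items. *)
Lemma frakG_eval0 g : triple_rel false (fun i j => phi (e_ F i j)) ->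
  @frakG F n hn g -> phi g = 0.
Proof.
move=> relE Gg.
have [E [EE H]] : exists E,
    (forall i j, phi (e_ F i j) = E i j) /\ triple_rel false E.
  by exists (fun i j => phi (e_ F i j)).
have Ht := triple_rel_tr H.
have exp2 (x : A) : x ^+ 2 = x * x by [].
have exp3 (x : A) : x ^+ 3 = x * x * x by rewrite exprS expr2 mulrA.
have exp5 (x : A) : x ^+ 5 = x * x * x * x * x.
  by rewrite !exprSr expr0 !mul1r.
case: Gg => [i j io jo|i j k ki jo|i j k jk io|i j k l il jk|i j io jo|i j io ji
  |i j io jo ij|i j io jo ij|i j ij io|i io|j jo|i j k kj ij|i j k ij kj
  |i io|i io|i io|i io|i io|i io|];
  match goal with |- _ ?f = _ =>
    let pf := eval_proof EE f in refine (etrans pf _) end;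
  rewrite ?exp2 ?exp3 ?exp5.
- rewrite (H i o o o o j) !eqxx expr0 (negPf jo) /= scale0r subr0.
  by rewrite !scale1r subrr.
- by rewrite (prod_indep H j o) ?subrr // eq_sym.
- by rewrite (prod_indep_tr H i o) ?subrr.
- by rewrite (prod_eq0 charF H).
- by rewrite (prod_diag o H) -[X in X + _]addrA -opprD addrAC subrK subrr.
- by rewrite (cube_unsorted H) // expr0 scale1r -addrA -opprD subrr.
- by rewrite (cube_sorted H) // subrr.
- by rewrite (cube_sorted Ht) ?subrr // eq_sym.
- rewrite (cube_unsorted Ht) // 1?eq_sym // expr1 scaleN1r.
  by rewrite addrAC subrK subrr.
- rewrite (cube_diag charF H) // expr0 scale1r scaler_nat.
  by rewrite -addrA -opprD subrr.
- rewrite (cube_diag charF Ht) // expr1 scaleN1r scaler_nat.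
  by rewrite addrAC subrK subrr.
- exact: (cube_eq0 o charF H).
- exact: (cube_eq0 o charF Ht).
- rewrite (half_mulrn2 (corner_half charF H io)) expr0 scale1r scalerDr.
  by rewrite -addrA -opprD subrr.
- rewrite (half_mulrn2 (corner_half charF Ht io)) expr1 scaleN1r scalerBr.
  by rewrite addrAC subrK subrr.
- rewrite -(corner_comm H) // (half_mulrn2 (corner_half charF H io)) expr0.
  by rewrite scale1r scalerDr -addrA -opprD subrr.
- rewrite -(corner_comm Ht) // (half_mulrn2 (corner_half charF Ht io)) expr1.
  by rewrite scaleN1r scalerBr addrAC subrK subrr.
- by rewrite (corner_cube charF H) // expr0 scale1r subrr.
- by rewrite (corner_cube charF Ht) // expr1 scaleN1r addNr.
- (* any index other than the first will do *)
  have hi : (1 < n)%N by [].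
  by rewrite (corner_fifth charF H (i := Ordinal hi)) ?subrr.
Qed.

End Vanishing.

Section Membership.
Variables (F : fieldType) (n : nat).
Local Notation c := (@coset F n).

Lemma env_ideal_coset (f : free_alg F n) : env_ideal f <-> c f = 0.
Proof.
rewrite -(raddf0 c); split=> [fI|/eqP].
  by apply/eqP; rewrite coset_eq subr0; apply/env_idealP.
by rewrite coset_eq subr0 => /env_idealP.
Qed.

Lemma frakG_env_ideal (charF : [pchar F] =i pred0) (hn : (2 <= n)%N) g :
  @frakG F n hn g -> env_ideal g.
Proof.
move=> Gg; apply/env_ideal_coset; apply: (frakG_eval0 charF _ Gg).
move=> i j k l m t.
by rewrite coset_relator expr0 scale1r /delta -!natrM !mulnb.
Qed.

End Membership.

(** * The deglex order as an order of natural numbers *)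

Section WordOrder.
Variable n : nat.
Hypothesis n_gt1 : (1 < n)%N.
Local Open Scope nat_scope.
Local Notation letter := ('I_n * 'I_n)%type.
Implicit Types (x y : letter) (s t : seq letter).

Definition digit x : nat := x.1 * n + x.2.

(** The number written in base n^2 by the digits a, s_1, s_2, and so on.  With
    the leading digit a = 1, longer words get larger numbers, so that deglex
    becomes the order of the numbers; this makes it well-founded. *)
Definition wordnum (a : nat) s : nat :=
  foldl (fun a x => a * (n * n) + digit x) a s.

Lemma digit_lt x : digit x < n * n.
Proof.
rewrite /digit; have := ltn_ord x.1; have := ltn_ord x.2.
move: (nat_of_ord x.1) (nat_of_ord x.2) => i j; nia.
Qed.

Lemma wordnumE a s : wordnum a s = a * (n * n) ^ size s + wordnum 0 s.
Proof.
elim: s a => [|x s IH] a; first by rewrite /= muln1 addn0.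
by rewrite /= IH (IH (0 * _ + _)) mul0n add0n expnS mulnDl addnA -!mulnA.
Qed.

Lemma wordnum_cat a s t : wordnum a (s ++ t) = wordnum (wordnum a s) t.
Proof. exact: foldl_cat. Qed.

Lemma wordnum_bound s : wordnum 0 s < (n * n) ^ size s.
Proof.
elim: s => [//|x s IH] /=; rewrite wordnumE mul0n add0n expnS.
have := digit_lt x; move: IH.
move: (digit x) (wordnum 0 s) ((n * n) ^ size s) => d a b.
by move: (n * n) => c; nia.
Qed.

Lemma wordnum_lt a b s t : size s = size t -> a < b -> wordnum a s < wordnum b t.
Proof.
move=> st ab; rewrite (wordnumE a) (wordnumE b) st.
have := wordnum_bound s; rewrite st.
move: ((n * n) ^ size t) (wordnum 0 s) (wordnum 0 t) => B u v; nia.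
Qed.

Lemma wordnum_size s t : size s < size t -> wordnum 1 s < wordnum 1 t.
Proof.
move=> st; rewrite (wordnumE 1 s) (wordnumE 1 t) !mul1n.
have Bs := wordnum_bound s.
have : (n * n) ^ (size s).+1 <= (n * n) ^ size t.
  by rewrite leq_exp2l //; nia.
rewrite expnS; have : 2 <= n * n by nia.
move: Bs; move: ((n * n) ^ size s) ((n * n) ^ size t).
move: (wordnum 0 s) (wordnum 0 t) => u v B C.
by move: (n * n) => c; nia.
Qed.

Lemma digit_le x y : ((x : 'I_n *l 'I_n) <= y)%O = (digit x <= digit y).
Proof.
rewrite leEprodlexi !leEord /digit /=; move: (ltn_ord x.2) (ltn_ord y.2).
move: (nat_of_ord x.1) (nat_of_ord x.2) (nat_of_ord y.1) (nat_of_ord y.2).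
move=> a b c d bn dn; case: (ltngtP a c) => /= ac; nia.
Qed.

Lemma lexi_wordnum s t : size s = size t ->
  ((s : seqlexi ('I_n *l 'I_n)%type) <= t)%O = (wordnum 0 s <= wordnum 0 t).
Proof.
elim: s t => [|x s IH] [|y t] //= [st].
rewrite [LHS]lexi_cons IH // !digit_le.
rewrite [in RHS](wordnumE (_ + _) s) [in RHS](wordnumE (_ + _) t).
rewrite !mul0n !add0n st.
have := wordnum_bound s; have := wordnum_bound t; rewrite st.
move: (wordnum 0 s) (wordnum 0 t) (digit x) (digit y) ((n * n) ^ size t).
move=> a b c d B aB bB.
by case: (ltngtP c d) => /= cd; apply/esym; nia.
Qed.

Lemma deglexE (u v : word n) : deglex u v = (wordnum 1 u <= wordnum 1 v).
Proof.
rewrite /deglex; case: (ltngtP (size u) (size v)) => /= uv.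
- by rewrite ltnW ?wordnum_size.
- by rewrite leqNgt wordnum_size.
- by rewrite lexi_wordnum // (wordnumE 1 u) (wordnumE 1 v) uv leq_add2l.
Qed.

Lemma wordnum1_inj s t : wordnum 1 s = wordnum 1 t -> s = t.
Proof.
move=> E; have st : size s = size t.
  by case: (ltngtP (size s) (size t)) => // /wordnum_size; rewrite E ltnn.
move: E; rewrite (wordnumE 1 s) (wordnumE 1 t) st => /addnI E.
have le1 := lexi_wordnum st; have le2 := lexi_wordnum (esym st).
move: le1 le2; rewrite E leqnn => le1 le2.
by apply: (@le_anti _ (seqlexi ('I_n *l 'I_n)%type)); rewrite le1 le2.
Qed.

Lemma wordnum_mono a b s t : wordnum 1 s < wordnum 1 t ->
  wordnum 1 (a ++ s ++ b) < wordnum 1 (a ++ t ++ b).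
Proof.
move=> st; case: (ltngtP (size s) (size t)) => lst.
- by apply: wordnum_size; rewrite !size_cat ltn_add2l ltn_add2r.
- by move: st; rewrite ltnNge ltnW // wordnum_size.
rewrite !wordnum_cat; apply: wordnum_lt => //.
move: st; rewrite (wordnumE 1 s) (wordnumE 1 t).
rewrite (wordnumE (wordnum 1 a) s) (wordnumE (wordnum 1 a) t) lst.
by rewrite !ltn_add2l.
Qed.

End WordOrder.

(** * Normal forms and a criterion for Groebner bases *)

Lemma ideal_genZ (F : fieldType) (n : nat) (S : free_alg F n -> Prop) c f :
  ideal_gen S f -> ideal_gen S (c *: f).
Proof. by move=> Jf; rewrite -mul_malgC; apply: ideal_genMl. Qed.

Lemma ideal_genB (R : nzRingType) (S : R -> Prop) f g :
  ideal_gen S f -> ideal_gen S g -> ideal_gen S (f - g).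
Proof.
by move=> Jf Jg; apply: ideal_genD => //; rewrite -mulN1r; apply: ideal_genMl.
Qed.

(** One reduction step w -> w - c^-1 (a g b), where c l is the leading term of g
    and w = a l b: what is left of w is made of the tail g - c l. *)
Lemma sandwich_tail (F : fieldType) (A : lalgType F) (a g l b w : A) (c : F) :
  (forall k (x y : A), k *: (x * y) = x * (k *: y)) ->
  c != 0 -> a * l * b = w ->
  w - - c^-1 *: (a * (g - c *: l) * b) = c^-1 *: (a * g * b).
Proof.
move=> Ar c0 lE; rewrite mulrBr mulrBl -Ar -scalerAl lE scaleNr opprK.
by rewrite scalerBr scalerA mulVf // scale1r addrC subrK.
Qed.

Section NormalForms.
Variables (F : fieldType) (n : nat) (S : free_alg F n -> Prop).
Hypothesis n_gt1 : (1 < n)%N.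
Local Notation J := (ideal_gen S).
Variables (G : free_alg F n -> Prop) (N : {pred word n}).
Local Notation rank := (wordnum 1).
Implicit Types (f g h : free_alg F n) (u v w : word n).

Hypothesis G_sub : forall g, G g -> J g.
Hypothesis G_red : forall w, w \notin N ->
  exists g l, [/\ G g, is_LM g l & infix l w].

(** The predicate P records a bound on the words of the normal form. *)
Definition normalizes (P : word n -> Prop) f :=
  exists2 h, J (f - h) & forall v, v \in msupp h -> v \in N /\ P v.

Lemma normalizes_add (P : word n -> Prop) f g :
  normalizes P f -> normalizes P g -> normalizes P (f + g).
Proof.
move=> [h Jh Ph] [k Jk Pk]; exists (h + k).
  by rewrite opprD addrACA; apply: ideal_genD.
move=> v vhk; have := fsubsetP (msuppD_le h k) _ vhk.
by rewrite in_fsetU => /orP[/Ph|/Pk].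
Qed.

Lemma normalizes_scale (P : word n -> Prop) c f :
  normalizes P f -> normalizes P (c *: f).
Proof.
move=> [h Jh Ph]; exists (c *: h); first by rewrite -scalerBr; apply: ideal_genZ.
by move=> v /(fsubsetP (msuppZ_le c h)) /Ph.
Qed.

Lemma normalizes_supp (P : word n -> Prop) f :
  (forall u, u \in msupp f -> normalizes P << u >>) -> normalizes P f.
Proof.
move=> nf; have mE u : << f@_u *g u >> = f@_u *: << u >> :> free_alg F n.
  by apply/malgP => k; rewrite mcoeffZ !mcoeffU mulrnAr mulr1.
rewrite [f in normalizes _ f]monalgE big_seq.
apply: (big_ind (normalizes P)) => [||u uf].
- by exists 0; [rewrite subr0; apply: ideal_gen0 | move=> v; rewrite msupp0].
- exact: normalizes_add.
by rewrite mE; apply/normalizes_scale/nf.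
Qed.

Lemma is_LM_tail g l : is_LM g l ->
  g@_l != 0 /\ forall v, v \in msupp (g - g@_l *: << l >>) -> (rank v < rank l)%N.
Proof.
move=> [lg maxl]; split; first by rewrite mcoeff_neq0.
move=> v; rewrite -mcoeff_neq0 mcoeffB mcoeffZ mcoeffU.
have [<-|lv] := eqVneq l v; first by rewrite mulr1 subrr eqxx.
rewrite mulr0n mulr0 subr0 mcoeff_neq0 => /maxl; rewrite deglexE //.
rewrite leq_eqVlt => /orP[/eqP/(wordnum1_inj n_gt1)/val_inj vl|//].
by rewrite vl eqxx in lv.
Qed.

(** Well-founded induction on deglex: the tail left by a reduction step consists
    of smaller words because deglex is multiplicative. *)
Lemma normalizes_word w : normalizes (fun v => (rank v <= rank w)%N) << w >>.
Proof.
have [m] := ubnP (rank w); elim: m w => // m IH w; rewrite ltnS => wm.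
have [wN|/G_red [g [l [Gg /is_LM_tail [c0 tail] lw]]]] := boolP (w \in N).
  exists << w >>; first by rewrite subrr; apply: ideal_gen0.
  by move=> v; rewrite msuppU1 in_fset1 => /eqP ->.
have /infixP [a [b wE]] := lw; pose r := g - g@_l *: << l >>.
pose wa : word n := FMonom a; pose wb : word n := FMonom b.
pose f := << wa >> * r * << wb >> : free_alg F n.
have low v : v \in msupp f -> (rank v < rank w)%N.
  case/msuppM_le => k1 [k2 [/msuppM_le [k3 [k4 [+ /tail k4l ->]]] + ->]].
  rewrite !msuppU1 !in_fset1 => /eqP -> /eqP ->.
  by rewrite !fmM -catA wE; apply: wordnum_mono.
have Jw : J (<< w >> - - (g@_l)^-1 *: f).
  have lE : << wa >> * << l >> * << wb >> = << w >> :> free_alg F n.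
    rewrite !malgM_def !fgmulUU !mulr1; congr mkmalgU; apply: val_inj.
    by rewrite /= !fmM wE catA.
  rewrite (sandwich_tail g (@free_alg_scalerAr F n) c0 lE).
  by apply/ideal_genZ/ideal_genMr/ideal_genMl/G_sub.
have [h Jh hN] : normalizes (fun v => (rank v <= rank w)%N) (- (g@_l)^-1 *: f).
  apply/normalizes_scale/normalizes_supp => u /low uw.
  have [h Jh hN] := IH u (leq_trans uw wm).
  by exists h => // v /hN [vN vu]; split=> //; rewrite (leq_trans vu) // ltnW.
exists h => //; rewrite -(subrK (- (g@_l)^-1 *: f) << w >>) -addrA.
exact: ideal_genD.
Qed.

Lemma exists_normal_form f : exists2 h, J (f - h) & {subset msupp h <= N}.
Proof.
have [|h Jh hN] := @normalizes_supp (fun _ => True) f.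
  by move=> u _; have [h Jh hN] := normalizes_word u; exists h => // v /hN [].
by exists h => // v /hN [].
Qed.

Lemma leading_word f : f != 0 -> exists w, is_LM f w.
Proof.
rewrite -msupp_eq0 => /fset0Pn [w0 w0f].
have [w _ wmax] := arg_maxnP (P := xpredT) (i0 := [` w0f]%fset)
  (fun w : msupp f => rank (val w)) isT.
exists (val w); split=> [|v vf]; first exact: valP.
by rewrite deglexE //; apply: (wmax [` vf]%fset).
Qed.

Hypothesis N_free : forall h, J h -> {subset msupp h <= N} -> h = 0.

(** If the leading word w of an element of J were in N, normalizing the tail
    would leave w in place, giving a nonzero element of J supported in N. *)
Lemma normal_words_groebner : groebner_basis J G.
Proof.
split=> // f Jf f0; have [w wf] := leading_word f0.
have [wN|/G_red [g [l [Gg gl lw]]]] := boolP (w \in N); last by exists g, l, w.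
have [c0 tail] := is_LM_tail wf.
pose P v := (rank v < rank w)%N.
have [h Jh hN] : normalizes P (f - f@_w *: << w >>).
  apply: normalizes_supp => u /tail uw.
  have [h Jh hN] := normalizes_word u.
  by exists h => // v /hN [vN vu]; split=> //; apply: leq_ltn_trans uw.
have/N_free h0 : J (f@_w *: << w >> + h).
  have -> : f@_w *: << w >> + h = f - (f - f@_w *: << w >> - h).
    by rewrite -addrA opprD addNKr opprB opprK addrC.
  exact: ideal_genB.
have/h0/(congr1 (mcoeff w)) : {subset msupp (f@_w *: << w >> + h) <= N}.
  move=> v /(fsubsetP (msuppD_le _ _)); rewrite in_fsetU => /orP[|/hN []//].
  by move=> /(fsubsetP (msuppZ_le _ _)); rewrite msuppU1 in_fset1 => /eqP ->.
rewrite mcoeffD mcoeffZ mcoeffUU mulr1 mcoeff0.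
have -> : h@_w = 0.
  apply/eqP; rewrite mcoeff_eq0; apply/negP => /hN [_].
  by rewrite /P ltnn.
by rewrite addr0 => /eqP; rewrite (negPf c0).
Qed.

End NormalForms.

(** * Leading monomials of the generators *)

(* Simplification must expose the letters of a word, not its number. *)
Arguments wordnum : simpl never.

Section LeadingMonomials.
Variables (F : fieldType) (n : nat).
Hypothesis n_gt1 : (1 < n)%N.
Implicit Types (f g r : free_alg F n) (s t : seq ('I_n * 'I_n)).

Definition mono s : free_alg F n := << FMonom s : word n >>.

Lemma mono_e i j : e_ F i j = mono [:: (i, j)].
Proof. by congr mkmalgU; apply: val_inj; rewrite /= fmU. Qed.

Lemma mono1 : 1 = mono [::].
Proof. by congr mkmalgU; apply: val_inj; rewrite /= fm1. Qed.

Lemma monoM f g s t : f = mono s -> g = mono t -> f * g = mono (s ++ t).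
Proof.
move=> -> ->; rewrite malgM_def fgmulUU mulr1; congr mkmalgU.
by apply: val_inj; rewrite /= fmM.
Qed.

Lemma monoX f s k : f = mono s -> f ^+ k = mono (flatten (nseq k s)).
Proof.
move=> fE; elim: k => [|k IH]; first by rewrite expr0 mono1.
by rewrite exprS; apply: monoM.
Qed.

Definition below s r := forall v, v \in msupp r -> (wordnum 1 v < wordnum 1 s)%N.

Lemma below_add s f g : below s f -> below s g -> below s (f + g).
Proof.
move=> fs gs v /(fsubsetP (msuppD_le f g)).
by rewrite in_fsetU => /orP[/fs|/gs].
Qed.

Lemma below_opp s f : below s f -> below s (- f).
Proof. by move=> fs v; rewrite msuppN => /fs. Qed.

Lemma below_scale s c f : below s f -> below s (c *: f).
Proof. by move=> fs v /(fsubsetP (msuppZ_le c f)) /fs. Qed.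

Lemma below_mono s f t : f = mono t -> (wordnum 1 t < wordnum 1 s)%N -> below s f.
Proof. by move=> -> ts v; rewrite msuppU1 in_fset1 => /eqP ->. Qed.

Lemma is_LM_mono f s : f = mono s -> is_LM f (FMonom s).
Proof.
move=> ->; split=> [|v]; rewrite msuppU1 in_fset1 //.
by move=> /eqP ->; rewrite deglexE.
Qed.

Lemma is_LM_add f r s : is_LM f (FMonom s) -> below s r ->
  is_LM (f + r) (FMonom s).
Proof.
move=> [sf smax] rs; have sr : FMonom s \notin msupp r.
  by apply/negP => /rs; rewrite ltnn.
split=> [|v /(fsubsetP (msuppD_le f r))].
  by rewrite -mcoeff_neq0 mcoeffD (mcoeff_outdom sr) addr0 mcoeff_neq0.
by rewrite in_fsetU => /orP[/smax //|/rs vs]; rewrite deglexE // ltnW.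
Qed.

Lemma wordnum_cons_lt a x y s t : size s = size t -> (digit x < digit y)%N ->
  (wordnum a (x :: s) < wordnum a (y :: t))%N.
Proof.
move=> st xy; apply: (@wordnum_lt n n_gt1 (_ + digit x) (_ + digit y) s t) => //.
by rewrite ltn_add2l.
Qed.

Lemma wordnum_cons a x s t : (forall b, wordnum b s < wordnum b t)%N ->
  (wordnum a (x :: s) < wordnum a (x :: t))%N.
Proof. by move=> st; exact: st. Qed.

End LeadingMonomials.

(** Builds a proof that the product f of letters is a single word, which is
    computed along the way. *)
Ltac mono_proof f :=
  lazymatch f with
  | ?a * ?b =>
      let pa := mono_proof a in let pb := mono_proof b in
      constr:(monoM pa pb)
  | ?a ^+ ?k => let pa := mono_proof a in constr:(monoX k pa)
  | e_ ?F ?i ?j => constr:(mono_e F i j)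
  end.

(** Words of different sizes are compared by size; otherwise a common prefix is
    skipped and the first differing digits are compared. *)
Ltac wordnum_tac n_gt1 :=
  first
  [ apply: (wordnum_size n_gt1); done
  | apply: (wordnum_cons_lt n_gt1); [done | rewrite /digit /=; nia]
  | apply: wordnum_cons => ?; wordnum_tac n_gt1 ].

Ltac below_tac n_gt1 :=
  lazymatch goal with
  | |- below _ (_ + _) => apply: below_add; below_tac n_gt1
  | |- below _ (- _) => apply: below_opp; below_tac n_gt1
  | |- below _ (_ *: _) => apply: below_scale; below_tac n_gt1
  | |- below _ ?f =>
      let p := mono_proof f in
      apply: (below_mono p); simpl; wordnum_tac n_gt1
  end.

Ltac LM_tac n_gt1 :=
  lazymatch goal with
  | |- is_LM (_ + _) _ =>
      apply: (is_LM_add n_gt1); [LM_tac n_gt1 | below_tac n_gt1]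
  | |- is_LM ?f _ => let p := mono_proof f in exact: (is_LM_mono n_gt1 p)
  end.

(** * Words that avoid the leading monomials *)

Section Reducible.
Variables (F : fieldType) (n : nat) (hn : (2 <= n)%N).
Local Notation o := (idx1 hn).
Implicit Types (s t : seq ('I_n * 'I_n)).

Definition reducible s := exists (g : free_alg F n) (l : word n),
  [/\ frakG hn g, is_LM g l & infix l s].

Lemma reducible_infix s t : infix s t -> reducible s -> reducible t.
Proof.
by move=> st [g [l [Gg gl ls]]]; exists g, l; split=> //; apply: infix_trans st.
Qed.

Lemma idx1_pos (i : 'I_n) : i != o -> (0 < i)%N.
Proof. by rewrite -val_eqE /= lt0n. Qed.

(** Uses a generator whose leading monomial is the whole word. *)
Ltac reduce_with G :=
  lazymatch goal with |- reducible ?s =>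
    eexists; exists (FMonom s); split;
    [exact: G | LM_tac hn | exact: infix_refl] end.

(** The four cases of equality between the inner indices j, k and between the
    outer indices i, l match the four families of quadratic generators. *)
Lemma reducible2 (i j k l : 'I_n) :
  reducible [:: (i, j); (k, l)] \/ (j = o /\ k = o) \/ (i = o /\ l = o).
Proof.
have := ltn_ord i; have := ltn_ord j; have := ltn_ord k; have := ltn_ord l.
move=> ln kn jn ii.
have [il|il] := eqVneq i l; have [jk|jk] := eqVneq j k; subst.
- have [io|io] := eqVneq l o; first by right; right.
  have [jo|jo] := eqVneq k o; first by right; left.
  have := idx1_pos io; have := idx1_pos jo => ko lo.
  left; reduce_with (@frakG_5 F n hn l k io jo).
- have [io|io] := eqVneq l o; first by right; right.
  have := idx1_pos io => lo.
  left; reduce_with (@frakG_3 F n hn l j k jk io).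
- have [io|io] := eqVneq k o; first by right; left.
  have := idx1_pos io => lo.
  left; rewrite eq_sym in il; reduce_with (@frakG_2 F n hn i k l il io).
- left; reduce_with (@frakG_4 F n hn i j k l il jk).
Qed.

(** Both factors of length two may be assumed irreducible; each then has one of
    two shapes, and the cubic generators deal with the four combinations. *)
Lemma reducible3 (a b c d p q : 'I_n) :
  [\/ reducible [:: (a, b); (c, d); (p, q)],
      [/\ a = o, b = o, c = o, d = o & p = o]
    | [/\ a = o, c = o, d = o, q = o & p != o]].
Proof.
(* the bounds on the indices are used when digits are compared *)
have := ltn_ord a; have := ltn_ord b; have := ltn_ord c; have := ltn_ord d.
have := ltn_ord p; have := ltn_ord q => q_lt p_lt d_lt c_lt b_lt a_lt.
have [r|ab] := reducible2 a b c d.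
  by constructor 1; apply: reducible_infix r; apply/infixP;
    exists [::], [:: (p, q)].
have [r|cd] := reducible2 c d p q.
  constructor 1; apply: reducible_infix r; apply/infixP.
  by exists [:: (a, b)], [::]; rewrite cats0.
case: ab cd => [[-> ->]|[-> ->]] [[E1 E2]|[E1 E2]]; subst.
- have [->|ao] := eqVneq a o; first by constructor 2.
  have a0 := idx1_pos ao; constructor 1.
  have [->|qo] := eqVneq q o.
    have oa : o != a by rewrite eq_sym.
    reduce_with (@frakG_6 F n hn a o ao oa).
  reduce_with (@frakG_1 F n hn a q ao qo).
- have [ad|ad] := eqVneq a d; have [pd|pd] := eqVneq p d; subst.
  + have [->|d0] := eqVneq d o; first by constructor 2.
    have dp := idx1_pos d0; constructor 1.
    reduce_with (@frakG_10 F n hn d d0).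
  + have [->|d0] := eqVneq d o; have [po|p0] := eqVneq p o; subst.
    * by constructor 2.
    * by constructor 3.
    * have dp := idx1_pos d0; constructor 1; reduce_with (@frakG_17 F n hn d d0).
    * have dp := idx1_pos d0; have pp := idx1_pos p0; constructor 1.
      reduce_with (@frakG_7 F n hn p d p0 d0 pd).
  + constructor 1; have [ao|a0] := eqVneq a o; subst.
      have d0 : d != o by rewrite eq_sym.
      have dp := idx1_pos d0; reduce_with (@frakG_14 F n hn d d0).
    have ap := idx1_pos a0; rewrite eq_sym in ad.
    reduce_with (@frakG_6 F n hn a d a0 ad).
  + constructor 1; reduce_with (@frakG_12 F n hn a d p pd ad).
- have [bc|bc] := eqVneq b c; have [qc|qc] := eqVneq q c; subst.
  + have [->|c0] := eqVneq c o; first by constructor 2.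
    have cp := idx1_pos c0; constructor 1.
    reduce_with (@frakG_11 F n hn c c0).
  + have [->|c0] := eqVneq c o; first by constructor 2.
    have cp := idx1_pos c0; constructor 1.
    have [qo|q0] := eqVneq q o; subst; first by reduce_with (@frakG_16 F n hn c c0).
    rewrite eq_sym in qc; reduce_with (@frakG_8 F n hn c q c0 q0 qc).
  + constructor 1; have [bo|b0] := eqVneq b o; subst.
      have c0 : c != o by rewrite eq_sym.
      have cp := idx1_pos c0; reduce_with (@frakG_15 F n hn c c0).
    have bp := idx1_pos b0; reduce_with (@frakG_9 F n hn b c bc b0).
  + constructor 1; reduce_with (@frakG_13 F n hn b c q bc qc).
- have [->|po] := eqVneq p o; last by constructor 3.
  have [->|bo] := eqVneq b o; first by constructor 2.
  have b0 := idx1_pos bo; constructor 1.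
  reduce_with (@frakG_9 F n hn b o bo bo).
Qed.

(** The shapes left by reducible3 can only overlap in a word that starts with
    E_oo E_oo E_oo, and the quartic generators reduce it unless the last letter
    is E_oo as well. *)
Lemma reducible4 (a b c d p q r t : 'I_n) :
  reducible [:: (a, b); (c, d); (p, q); (r, t)] \/
  [:: (a, b); (c, d); (p, q); (r, t)] = nseq 4 (o, o).
Proof.
have := reducible3 c d p q r t; have := reducible3 a b c d p q.
case=> [w|[-> -> -> -> ->]|[-> -> -> -> p0]].
- by left; apply: reducible_infix w; apply/infixP; exists [::], [:: (r, t)].
- case=> [w|[_ _ _ -> ->]|[_ _ -> -> r0]].
  + left; apply: reducible_infix w; apply/infixP.
    by exists [:: (o, o)], [::]; rewrite cats0.
  + have [->|t0] := eqVneq t o; [by right | left].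
    have tp := idx1_pos t0; reduce_with (@frakG_18 F n hn t t0).
  + left; have rp := idx1_pos r0; reduce_with (@frakG_19 F n hn r r0).
case=> [w|[_ _ po]|[_ po]].
- left; apply: reducible_infix w; apply/infixP.
  by exists [:: (o, b)], [::]; rewrite cats0.
- by rewrite po eqxx in p0.
- by rewrite po eqxx in p0.
Qed.

Lemma reducible5 x1 x2 x3 x4 x5 s : reducible [:: x1, x2, x3, x4, x5 & s].
Proof.
case: x1 x2 x3 x4 x5 => [a1 b1] [a2 b2] [a3 b3] [a4 b4] [a5 b5].
have [w|E1] := reducible4 a1 b1 a2 b2 a3 b3 a4 b4.
  by apply: reducible_infix w; apply/infixP; exists [::], ((a5, b5) :: s).
have [w|E2] := reducible4 a2 b2 a3 b3 a4 b4 a5 b5.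
  by apply: reducible_infix w; apply/infixP; exists [:: (a1, b1)], s.
case: E1 E2 => -> -> -> -> -> -> -> -> [-> ->].
have w : reducible (nseq 5 (o, o)).
  by rewrite /=; reduce_with (@frakG_20 F n hn).
by apply: reducible_infix w; apply/infixP; exists [::], s.
Qed.

Local Notation Omega := (enum 'I_n).

Definition normal_words : seq (seq ('I_n * 'I_n)) :=
  [:: [::]]
  ++ [seq [:: (i, j)] | i <- Omega, j <- Omega]
  ++ [seq [:: (i, o); (o, j)] | i <- Omega, j <- Omega]
  ++ [seq [:: (o, o); (o, o); (o, j)] | j <- Omega]
  ++ [:: nseq 4 (o, o)]
  ++ [seq [:: (o, p.1); (p.2, o)] | p <- enum {: 'I_n * 'I_n} & p != (o, o)]
  ++ [seq [:: (o, p.1); (o, o); (p.2, o)]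
     | p <- enum {: 'I_n * 'I_n} & p.2 != o].

Lemma reducible_not_normal s : s \notin normal_words -> reducible s.
Proof.
move=> sN.
have NP (P : Prop) : (s \in normal_words \/ P) -> P.
  by case=> // sI; rewrite sI in sN.
apply: NP; rewrite /normal_words !mem_cat.
move: s {sN} => [|[a b] [|[c d] [|[p q] [|[r t] [|x s]]]]].
- by left.
- left; apply/orP; right; apply/orP; left.
  by apply/allpairsP; exists (a, b); rewrite !mem_enum.
- have [w|[[-> ->]|[-> ->]]] := reducible2 a b c d; first by right.
    left; do 2![apply/orP; right]; apply/orP; left.
    by apply/allpairsP; exists (a, d); rewrite !mem_enum.
  (* E_oo E_oo has both quadratic shapes; it is listed with the first one *)
  have [bco|bco] := eqVneq (b, c) (o, o).
    case: bco => -> ->; left; do 2![apply/orP; right]; apply/orP; left.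
    by apply/allpairsP; exists (o, o); rewrite !mem_enum.
  left; do 5![apply/orP; right]; apply/orP; left.
  by apply/mapP; exists (b, c) => //; rewrite mem_filter mem_enum andbT.
- have [w|[-> -> -> -> ->]|[-> -> -> -> p0]] := reducible3 a b c d p q.
  + by right.
  + left; do 3![apply/orP; right]; apply/orP; left.
    by apply/mapP; exists q; rewrite ?mem_enum.
  + left; do 6![apply/orP; right].
    by apply/mapP; exists (b, p) => //; rewrite mem_filter mem_enum andbT.
- have [w| ->] := reducible4 a b c d p q r t; first by right.
  by left; do 4![apply/orP; right]; apply/orP; left; rewrite mem_seq1.
- by right; exact: reducible5.
Qed.

Lemma frakB_mono : frakB F hn = map (@mono F n) normal_words.
Proof.
rewrite /frakB /normal_words !map_cat /= mono1.
congr (_ :: _); congr (_ ++ _).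
  rewrite map_allpairs; apply: eq_allpairs => // i j; exact: mono_e.
congr (_ ++ _).
  rewrite map_allpairs; apply: eq_allpairs => // i j.
  exact: (monoM (mono_e F i o) (mono_e F o j)).
congr (_ ++ _).
  rewrite -map_comp; apply: eq_map => j.
  exact: (monoM (monoX 2 (mono_e F o o)) (mono_e F o j)).
congr (_ :: _); first exact: (monoX 4 (mono_e F o o)).
congr (_ ++ _); rewrite -map_comp; apply: eq_map => p.
  exact: (monoM (mono_e F o p.1) (mono_e F p.2 o)).
exact: (monoM (monoM (mono_e F o p.1) (mono_e F o o)) (mono_e F p.2 o)).
Qed.

Lemma size_normal_words : size normal_words = (4 * n ^ 2 + 1)%N.
Proof.
rewrite /normal_words !size_cat !size_allpairs !size_map -!enumT size_enum_ord.
have -> : size [seq p <- enum {: 'I_n * 'I_n} | p != (o, o)] = (n * n).-1.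
  have := cardC1 ((o, o) : 'I_n * 'I_n); rewrite card_prod card_ord => <-.
  rewrite cardE /enum_mem -filter_predI; congr size.
  by apply: eq_filter => p; rewrite !inE andbT.
have -> : size [seq p <- enum {: 'I_n * 'I_n} | p.2 != o] = (n * n.-1)%N.
  have := cardX (mem 'I_n) (predC1 o); rewrite cardC1 card_ord => <-.
  rewrite cardE /enum_mem -filter_predI; congr size.
  by apply: eq_filter => p; rewrite !inE andbT.
by rewrite /=; move: hn; case: (n) => // m _; rewrite /=; nia.
Qed.

End Reducible.

Ltac split_membership := repeat match goal with
  | |- is_true (_ || _) -> _ => case/orP
  | |- is_true (_ \in [seq _ | _ <- _, _ <- _]) -> _ =>
      case/allpairsP => [[? ?] [_ _ ->]]
  | |- is_true (_ \in [seq _ | _ <- [seq _ <- _ | _]]) -> _ =>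
      case/mapP => [[? ?]]; rewrite mem_filter => /andP[] /= ? _ ->
  | |- is_true (_ \in [seq _ | _ <- _]) -> _ => case/mapP => [? _ ->]
  | |- is_true (_ \in [:: _]) -> _ => rewrite mem_seq1 => /eqP ->
  end.

Section Uniq.
Variables (n : nat) (hn : (2 <= n)%N).
Local Notation o := (idx1 hn).

Lemma uniq_cat_disjoint (T : eqType) (s t : seq T) :
  uniq s -> uniq t -> (forall x, x \in s -> x \in t -> False) -> uniq (s ++ t).
Proof.
move=> us ut st; rewrite cat_uniq us ut andbT.
by apply/hasPn => x xt; apply/negP => /st; apply.
Qed.

Lemma uniq_normal_words : uniq (normal_words hn).
Proof.
have uO := enum_uniq (mem 'I_n).
have uP := enum_uniq (mem {: 'I_n * 'I_n}).
rewrite /normal_words.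
do 6?[apply: uniq_cat_disjoint];
  rewrite ?allpairs_uniq ?map_inj_uniq ?filter_uniq //.
all: try by rewrite -enumT.
all: try by move=> [a b] [c d] _ _ [-> ->].
all: try by move=> a b [->].
all: try by move=> [a b] [c d] [-> ->].
all: rewrite -?enumT => s; rewrite ?mem_cat.
all: split_membership.
(* Two blocks can only share a word excluded by the condition on the latter. *)
all: first
  [ by rewrite mem_seq1 => /eqP
  | by case/allpairsP => [[? ?] [_ _]]
  | by case/mapP => [[? ?]]; rewrite mem_filter => /andP[] /= N _;
    case=> *; subst; rewrite eqxx in N
  | by case/mapP ].
Qed.

End Uniq.

(** * Evaluation of the free algebra at a family of elements *)

Section Evaluation.
Variables (F : fieldType) (n : nat) (A : algType F) (E : 'I_n -> 'I_n -> A).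

Definition ev_word (w : seq ('I_n * 'I_n)) : A := \prod_(x <- w) E x.1 x.2.

Definition ev_monom (w : word n) : A := ev_word w.

Lemma ev_monom_mmorphism : mmorphism ev_monom.
Proof.
rewrite /ev_monom; split=> [u v|]; first by rewrite /ev_word fmM big_cat.
by rewrite /ev_word fm1 big_nil.
Qed.

HB.instance Definition _ :=
  isMultiplicative.Build (word n) A ev_monom ev_monom_mmorphism.

Definition ev : free_alg F n -> A := mmap (GRing.in_alg A) ev_monom.

Lemma ev_zmod_morphism : zmod_morphism ev.
Proof. by move=> f g; apply: mmapB. Qed.

Lemma ev_monoid_morphism : monoid_morphism ev.
Proof.
have [|evM ev1] := @commr_mmap_is_multiplicative _ _ _ (GRing.in_alg A) ev_monom.
  by move=> h u v; rewrite /GRing.comm mulr_algl mulr_algr.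
by split.
Qed.

Lemma ev_scalable : scalable ev.
Proof. by move=> c f; rewrite /ev mmapZ mulr_algl. Qed.

HB.instance Definition _ :=
  GRing.isZmodMorphism.Build (free_alg F n) A ev ev_zmod_morphism.
HB.instance Definition _ :=
  GRing.isMonoidMorphism.Build (free_alg F n) A ev ev_monoid_morphism.
HB.instance Definition _ :=
  GRing.isScalable.Build F (free_alg F n) A _ ev ev_scalable.

Lemma ev_mono s : ev (mono F s) = ev_word s.
Proof. by rewrite /ev /mono mmapU mulr_algl scale1r. Qed.

Lemma ev_e i j : ev (e_ F i j) = E i j.
Proof. by rewrite mono_e ev_mono /ev_word big_seq1. Qed.

(** The universal property of the envelope, in the form of the vanishing of the
    evaluation on the ideal. *)
Lemma ev_ideal f : triple_rel false E -> env_ideal f -> ev f = 0.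
Proof.
move=> H; elim=> [x [i [j [k [l [m [t ->]]]]]]| |g h _ g0 _ h0|a g _ g0|a g _ g0].
- rewrite /relator; match goal with |- _ ?f = _ =>
    let pf := eval_proof ev_e f in rewrite [LHS]pf end.
  rewrite (H i j k l m t) /delta -!natrM !mulnb expr0 scale1r.
  by rewrite addrAC subrK subrr.
- exact: raddf0.
- by rewrite raddfD /= g0 h0 addr0.
- by rewrite rmorphM /= g0 mulr0.
- by rewrite rmorphM /= g0 mul0r.
Qed.

Lemma sum_supp (s : seq (seq ('I_n * 'I_n))) (h : free_alg F n) : uniq s ->
  (forall w, w \in msupp h -> (w : seq _) \in s) ->
  h = \sum_(w <- s) h@_(FMonom w) *: mono F w.
Proof.
move=> us hs; apply/malgP => k; rewrite raddf_sum /=.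
have cE w : (h@_(FMonom w) *: mono F w)@_k = h@_(FMonom w) *+ (w == k).
  by rewrite mcoeffZ mcoeffU mulr_natr.
under eq_bigr => w _ do rewrite cE.
have [ks|ks] := boolP ((k : seq _) \in s).
  rewrite (bigD1_seq (k : seq _)) //= eqxx big1 ?addr0 => [|w /negPf ->] //.
  by congr (h@_ _); apply: val_inj.
rewrite big_seq big1 => [|w ws].
  by rewrite mcoeff_outdom //; apply: contra ks => /hs.
by have [wk|//] := eqVneq w (k : seq _); rewrite -wk ws in ks.
Qed.

Lemma ev_sum_supp s h : uniq s ->
  (forall w : word n, w \in msupp h -> (w : seq _) \in s) ->
  ev h = \sum_(w <- s) h@_(FMonom w) *: ev_word w.
Proof.
move=> us hs; rewrite {1}(sum_supp us hs) raddf_sum.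
by apply: eq_bigr => w _; rewrite /= linearZ /= ev_mono.
Qed.

End Evaluation.

(** * Five matrix representations separate the normal words *)

Section BigNormal.
Variables (n : nat) (hn : (2 <= n)%N).
Variables (V : nmodType) (f : seq ('I_n * 'I_n) -> V).
Local Notation o := (idx1 hn).

Lemma big_normal_words :
  \sum_(w <- normal_words hn) f w =
  f [::] + (\sum_i \sum_j f [:: (i, j)]
  + (\sum_i \sum_j f [:: (i, o); (o, j)]
  + (\sum_j f [:: (o, o); (o, o); (o, j)]
  + (f (nseq 4 (o, o))
  + (\sum_(p : 'I_n * 'I_n | p != (o, o)) f [:: (o, p.1); (p.2, o)]
  + \sum_(p : 'I_n * 'I_n | p.2 != o) f [:: (o, p.1); (o, o); (p.2, o)]))))).
Proof.
rewrite /normal_words !big_cat !big_seq1.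
rewrite !big_allpairs_dep !big_map !big_filter !big_enum_cond /=.
congr (_ + (_ + (_ + (_ + (_ + (_ + _)))))).
- by rewrite -enumT big_enum; apply: eq_bigr => i _; exact: big_enum.
- by rewrite -enumT big_enum; apply: eq_bigr => i _; exact: big_enum.
Qed.

End BigNormal.

Section MatrixReps.
Variables (F : fieldType) (m : nat) (hn : (2 <= m.+1)%N).
Local Notation n := m.+1.
Local Notation o := (idx1 hn).

(** The images of the letters under a |-> l a. *)
Definition unit_rep (l : F) (i j : 'I_n) : 'M[F]_n := l *: delta_mx i j.

Lemma unit_repM l k i j p q : (l *: delta_mx i j : 'M[F]_n) * (k *: delta_mx p q)
  = (l * k * (j == p)%:R) *: delta_mx i q.
Proof.
rewrite -scalerAl -scalerAr scalerA /GRing.mul /= mul_delta_mx_cond.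
by rewrite -scaler_nat scalerA.
Qed.

(** A product of three letters carries l^3 = l^2 l.  For l^2 = -1 the sign is
    wrong, and transposition corrects it. *)
Lemma unit_rep_rel (s : bool) (l : F) :
  l ^+ 2 = (-1) ^+ s -> triple_rel s (unit_rep l).
Proof.
move=> l2 i j k p q t; rewrite /unit_rep !unit_repM -l2 scalerBr !scalerA.
by rewrite -!mulnb !natrM; congr (_ *: _ - _ *: _); ring.
Qed.

Lemma sum_delta_cond (Q : pred ('I_n * 'I_n)) (c : 'I_n * 'I_n -> F) :
  \sum_(p | Q p) c p *: delta_mx p.1 p.2
    = \matrix_(x, y) (c (x, y) * (Q (x, y))%:R) :> 'M[F]_n.
Proof.
rewrite [RHS]matrix_sum_delta big_mkcond [RHS]pair_bigA /=.
by apply: eq_bigr => -[x y] _; rewrite mxE /=; case: (Q _);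
  rewrite ?mulr1 ?mulr0 ?scale0r.
Qed.

Lemma sum_delta (c : 'I_n -> 'I_n -> F) :
  \sum_i \sum_j c i j *: delta_mx i j = \matrix_(x, y) c x y :> 'M[F]_n.
Proof.
rewrite [RHS]matrix_sum_delta.
by apply: eq_bigr => i _; apply: eq_bigr => j _; rewrite mxE.
Qed.

Variables (h : free_alg F n) (l : F).
Hypothesis h_normal : forall w : word n,
  w \in msupp h -> (w : seq _) \in normal_words hn.
Local Notation k w := (h@_(FMonom w)).
Local Notation E := (unit_rep l).
Local Notation E' := (fun i j => unit_rep l j i).

Lemma ev_normal x y : (ev E h : 'M[F]_n) x y =
  k [::] * (x == y)%:R + l * k [:: (x, y)] + l ^+ 2 * k [:: (x, o); (o, y)]
  + l ^+ 3 * (k [:: (o, o); (o, o); (o, y)] * (x == o)%:R)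
  + l ^+ 4 * (k (nseq 4 (o, o)) * ((x == o) && (y == o))%:R)
  + l ^+ 2 * ((\sum_(p : 'I_n * 'I_n | p != (o, o))
               k [:: (o, p.1); (p.2, o)] * (p.1 == p.2)%:R)
             * ((x == o) && (y == o))%:R).
Proof.
have W1 i j : ev_word E [:: (i, j)] = l *: delta_mx i j.
  by rewrite /ev_word big_seq1.
have W2 i j p q : ev_word E [:: (i, j); (p, q)]
    = (l ^+ 2 * (j == p)%:R) *: delta_mx i q.
  by rewrite /ev_word big_cons big_seq1 unit_repM.
have W3 i j p q r t : ev_word E [:: (i, j); (p, q); (r, t)]
    = (l ^+ 3 * (q == r)%:R * (j == p)%:R) *: delta_mx i t.
  rewrite /ev_word 2!big_cons big_seq1 /= !unit_repM; congr (_ *: _); ring.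
have W4 : ev_word E (nseq 4 (o, o)) = l ^+ 4 *: delta_mx o o.
  rewrite /ev_word 3!big_cons big_seq1 /= !unit_repM eqxx !mulr1.
  by congr (_ *: _); ring.
rewrite (ev_sum_supp E (uniq_normal_words hn) h_normal) big_normal_words.
rewrite [\sum_(p | p.2 != o) _]big1 => [|p po]; last first.
  by rewrite W3 [o == p.2]eq_sym (negPf po) mulr0 mul0r scale0r scaler0.
have S1 : \sum_i \sum_j k [:: (i, j)] *: ev_word E [:: (i, j)]
    = \matrix_(i, j) (k [:: (i, j)] * l).
  rewrite -sum_delta; apply: eq_bigr => i _; apply: eq_bigr => j _.
  by rewrite W1 scalerA.
have S2 : \sum_i \sum_j k [:: (i, o); (o, j)]
      *: ev_word E [:: (i, o); (o, j)]
    = \matrix_(i, j) (k [:: (i, o); (o, j)] * l ^+ 2).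
  rewrite -sum_delta; apply: eq_bigr => i _; apply: eq_bigr => j _.
  by rewrite W2 eqxx mulr1 scalerA.
have S3 : \sum_j k [:: (o, o); (o, o); (o, j)]
      *: ev_word E [:: (o, o); (o, o); (o, j)]
    = \matrix_(i, j) (k [:: (o, o); (o, o); (o, j)] * l ^+ 3 * (i == o)%:R).
  apply/matrixP => i j; rewrite summxE (bigD1 j) //= big1 => [|q qj].
    by rewrite W3 !eqxx !mulr1 !mxE eqxx andbT addr0 mulrA.
  by rewrite W3 !mxE [j == q]eq_sym (negPf qj) andbF !mulr0.
have S5 : \sum_(p : 'I_n * 'I_n | p != (o, o))
      k [:: (o, p.1); (p.2, o)] *: ev_word E [:: (o, p.1); (p.2, o)]
    = (\sum_(p : 'I_n * 'I_n | p != (o, o))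
         k [:: (o, p.1); (p.2, o)] * (p.1 == p.2)%:R)
      *: (l ^+ 2 *: delta_mx o o).
  rewrite scaler_suml; apply: eq_bigr => p _.
  by rewrite W2 !scalerA mulrA mulrAC.
rewrite S1 S2 S3 S5 W4 /ev_word big_nil !mxE; ring.
Qed.

Lemma ev_transposed x y : (ev E' h : 'M[F]_n) x y =
  k [::] * (x == y)%:R + l * k [:: (y, x)]
  + l ^+ 2 * ((\sum_i k [:: (i, o); (o, i)]) * ((x == o) && (y == o))%:R)
  + l ^+ 3 * (k [:: (o, o); (o, o); (o, o)] * ((x == o) && (y == o))%:R)
  + l ^+ 4 * (k (nseq 4 (o, o)) * ((x == o) && (y == o))%:R)
  + l ^+ 2 * (k [:: (o, x); (y, o)] * ((x, y) != (o, o))%:R)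
  + l ^+ 3 * (k [:: (o, x); (o, o); (y, o)] * (y != o)%:R).
Proof.
have W1 i j : ev_word E' [:: (i, j)] = l *: delta_mx j i.
  by rewrite /ev_word big_seq1.
have W2 i j p q : ev_word E' [:: (i, j); (p, q)]
    = (l ^+ 2 * (i == q)%:R) *: delta_mx j p.
  by rewrite /ev_word big_cons big_seq1 unit_repM.
have W3 i j p q r t : ev_word E' [:: (i, j); (p, q); (r, t)]
    = (l ^+ 3 * (p == t)%:R * (i == q)%:R) *: delta_mx j r.
  by rewrite /ev_word 2!big_cons big_seq1 /= !unit_repM; congr (_ *: _); ring.
have W4 : ev_word E' (nseq 4 (o, o)) = l ^+ 4 *: delta_mx o o.
  rewrite /ev_word 3!big_cons big_seq1 /= !unit_repM eqxx !mulr1.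
  by congr (_ *: _); ring.
rewrite (ev_sum_supp E' (uniq_normal_words hn) h_normal) big_normal_words.
have S1 : \sum_i \sum_j k [:: (i, j)] *: ev_word E' [:: (i, j)]
    = \matrix_(i, j) (k [:: (j, i)] * l).
  rewrite exchange_big -sum_delta; apply: eq_bigr => i _; apply: eq_bigr => j _.
  by rewrite W1 scalerA.
have S2 : \sum_i \sum_j k [:: (i, o); (o, j)]
      *: ev_word E' [:: (i, o); (o, j)]
    = (\sum_i k [:: (i, o); (o, i)]) *: (l ^+ 2 *: delta_mx o o).
  rewrite scaler_suml; apply: eq_bigr => i _.
  rewrite (bigD1 i) //= big1 => [|j ji].
    by rewrite W2 eqxx mulr1 addr0.
  by rewrite W2 eq_sym (negPf ji) mulr0 scale0r scaler0.
have S3 : \sum_j k [:: (o, o); (o, o); (o, j)]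
      *: ev_word E' [:: (o, o); (o, o); (o, j)]
    = k [:: (o, o); (o, o); (o, o)] *: (l ^+ 3 *: delta_mx o o).
  rewrite (bigD1 o) //= big1 => [|j jo]; first by rewrite W3 !eqxx !mulr1 addr0.
  by rewrite W3 [o == j]eq_sym (negPf jo) mulr0 mul0r scale0r scaler0.
have S5 : \sum_(p : 'I_n * 'I_n | p != (o, o))
      k [:: (o, p.1); (p.2, o)] *: ev_word E' [:: (o, p.1); (p.2, o)]
    = \matrix_(i, j) (k [:: (o, i); (j, o)] * l ^+ 2 * ((i, j) != (o, o))%:R).
  rewrite -(sum_delta_cond (fun p => p != (o, o))
    (fun p => k [:: (o, p.1); (p.2, o)] * l ^+ 2)).
  apply: eq_bigr => p _.
  by rewrite W2 eqxx mulr1 scalerA.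
have S6 : \sum_(p : 'I_n * 'I_n | p.2 != o)
      k [:: (o, p.1); (o, o); (p.2, o)]
        *: ev_word E' [:: (o, p.1); (o, o); (p.2, o)]
    = \matrix_(i, j) (k [:: (o, i); (o, o); (j, o)] * l ^+ 3 * (j != o)%:R).
  rewrite -(sum_delta_cond (fun p => p.2 != o)
    (fun p => k [:: (o, p.1); (o, o); (p.2, o)] * l ^+ 3)).
  apply: eq_bigr => p _.
  by rewrite W3 !eqxx !mulr1 scalerA.
rewrite S1 S2 S3 S5 S6 W4 /ev_word big_nil !mxE; ring.
Qed.

End MatrixReps.

Section Independence.
Variables (F : closedFieldType) (m : nat) (hn : (2 <= m.+1)%N).
Hypothesis charF : [pchar F] =i pred0.
Local Notation n := m.+1.
Local Notation o := (idx1 hn).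

Lemma double_eq0 (a : F) : a + a = 0 -> a = 0.
Proof.
move/eqP; rewrite -mulr2n -mulr_natr mulf_eq0 ((pcharf0P F).1 charF) orbF.
by move/eqP.
Qed.

Lemma even_odd_eq0 (l u v : F) : l != 0 -> u + l * v = 0 -> u - l * v = 0 ->
  u = 0 /\ v = 0.
Proof.
move=> l0 uv uv'; have u0 : u = 0.
  apply: double_eq0; have -> : u + u = (u + l * v) + (u - l * v) by ring.
  by rewrite uv uv' addr0.
by move: uv; rewrite u0 add0r => /eqP; rewrite mulf_eq0 (negPf l0) => /eqP.
Qed.

Lemma exists_sqrtN1 : exists l : F, l ^+ 2 = -1.
Proof.
have [l lE] := @solve_monicpoly F 2 (fun i => if i == 0%N then -1 else 0) isT.
by exists l; rewrite lE !big_ord_recl big_ord0 /= mul0r mulr1 !addr0.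
Qed.

Variable h : free_alg F n.
Hypothesis h_normal : forall w : word n,
  w \in msupp h -> (w : seq _) \in normal_words hn.
Hypothesis h_ideal : env_ideal h.
Local Notation k w := (h@_(FMonom w)).

(** Evaluation at the zero family, the trivial representation. *)
Lemma normal_coef1_eq0 : k [::] = 0.
Proof.
pose E (i j : 'I_n) : 'M[F]_n := 0.
have H : triple_rel false E.
  by move=> i j a b c d; rewrite /E !mulr0 subrr !scaler0 subrr scaler0.
have := congr1 (fun A : 'M[F]_n => A o o) (ev_ideal H h_ideal).
rewrite /= (ev_sum_supp E (uniq_normal_words hn) h_normal) (bigD1_seq [::]) //=.
- rewrite big1_seq => [|w /andP [w0 _]].
    by rewrite addr0 /ev_word big_nil !mxE eqxx mulr1.
  by case: w w0 => // x w _; rewrite /ev_word big_cons mul0r scaler0.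
- exact: uniq_normal_words.
Qed.

(** The entries of the two matrices ev_normal (for l = 1 and l = -1) and
    ev_transposed (for both square roots l of -1) vanish.  Odd powers of l are
    multiples of l, so the parts of odd and of even degree vanish separately. *)
Lemma normal_equations x y :
  [/\ k [:: (x, y)] + k [:: (o, o); (o, o); (o, y)] * (x == o)%:R = 0
    , k [:: (x, o); (o, y)] + (k (nseq 4 (o, o))
        + \sum_(p : 'I_n * 'I_n | p != (o, o))
            k [:: (o, p.1); (p.2, o)] * (p.1 == p.2)%:R)
        * ((x == o) && (y == o))%:R = 0
    , k [:: (y, x)]
      - k [:: (o, o); (o, o); (o, o)] * ((x == o) && (y == o))%:R
      - k [:: (o, x); (o, o); (y, o)] * (y != o)%:R = 0
    & (k (nseq 4 (o, o)) - \sum_i k [:: (i, o); (o, i)])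
        * ((x == o) && (y == o))%:R
      - k [:: (o, x); (y, o)] * ((x, y) != (o, o))%:R = 0].
Proof.
have c0 := normal_coef1_eq0.
have evN l : l ^+ 2 = 1 -> (ev (unit_rep l) h : 'M[F]_n) x y = 0.
  move=> l2; rewrite (ev_ideal _ h_ideal) ?mxE //.
  by apply: unit_rep_rel; rewrite expr0.
have evT l : l ^+ 2 = -1 -> (ev (fun i j => unit_rep l j i) h : 'M[F]_n) x y = 0.
  move=> l2; rewrite (ev_ideal _ h_ideal) ?mxE //.
  by apply: (triple_rel_tr (s := true)); apply: unit_rep_rel; rewrite expr1.
have [l l2] := exists_sqrtN1.
have l0 : l != 0 by rewrite -sqrf_eq0 l2 oppr_eq0 oner_eq0.
have N1 := evN 1 (expr1n _ _).
have := evN (-1); rewrite sqrrN expr1n => /(_ erefl) N2.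
have T1 := evT l l2; have := evT (- l); rewrite sqrrN => /(_ l2) T2.
have l3 : l ^+ 3 = - l by rewrite exprS l2 mulrN1.
have l4 : l ^+ 4 = 1 by rewrite -[4%N]/(2 * 2)%N exprM l2 sqrrN expr1n.
have nl2 : (- l) ^+ 2 = -1 by rewrite sqrrN.
have nl3 : (- l) ^+ 3 = l by rewrite exprS nl2 mulrN1 opprK.
have nl4 : (- l) ^+ 4 = 1 by rewrite -[4%N]/(2 * 2)%N exprM nl2 sqrrN expr1n.
move: N1 N2 T1 T2; rewrite !ev_normal // !ev_transposed // c0.
rewrite l2 l3 l4 nl2 nl3 nl4.
move: (k [:: (x, y)]) (k [:: (y, x)]) (k [:: (x, o); (o, y)]) => a1 a2 b.
move: (k [:: (o, o); (o, o); (o, y)]) (k (nseq 4 (o, o))) => d z.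
move: (\sum_(p | _) _) (\sum_i _) (k [:: (o, o); (o, o); (o, o)]) => tp tb d0.
move: (k [:: (o, x); (o, o); (y, o)]) (k [:: (o, x); (y, o)]) => q p.
move: ((x == o)%:R : F) (((x == o) && (y == o))%:R : F) => e1 e2.
move: (((x, y) != (o, o))%:R : F) ((y != o)%:R : F) => e3 e4 N1 N2 T1 T2.
have [||Y X] := @even_odd_eq0 1 (b + (z + tp) * e2) (a1 + d * e1) (oner_neq0 _).
- by rewrite -[RHS]N1; ring.
- by rewrite -[RHS]N2; ring.
have [||Y' X'] :=
  @even_odd_eq0 l ((z - tb) * e2 - p * e3) (a2 - d0 * e2 - q * e4) l0.
- by rewrite -[RHS]T1; ring.
- by rewrite -[RHS]T2; ring.
by [].
Qed.

Lemma normal_coefs_eq0 w : w \in normal_words hn -> k w = 0.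
Proof.
have NX x y : k [:: (x, y)]
    + k [:: (o, o); (o, o); (o, y)] * (x == o)%:R = 0.
  by have [] := normal_equations x y.
have NY x y : k [:: (x, o); (o, y)] + (k (nseq 4 (o, o))
      + \sum_(p : 'I_n * 'I_n | p != (o, o))
          k [:: (o, p.1); (p.2, o)] * (p.1 == p.2)%:R)
      * ((x == o) && (y == o))%:R = 0.
  by have [] := normal_equations x y.
have TX x y : k [:: (y, x)]
    - k [:: (o, o); (o, o); (o, o)] * ((x == o) && (y == o))%:R
    - k [:: (o, x); (o, o); (y, o)] * (y != o)%:R = 0.
  by have [] := normal_equations x y.
have TY x y : (k (nseq 4 (o, o)) - \sum_i k [:: (i, o); (o, i)])
      * ((x == o) && (y == o))%:R
    - k [:: (o, x); (y, o)] * ((x, y) != (o, o))%:R = 0.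
  by have [] := normal_equations x y.
(* odd degree: by NX, k(oo oo oj) is the opposite of k(oj); by TX, k(oj) is zero
   for j <> o and equal to k(oo oo oo) for j = o *)
have d0 j : k [:: (o, o); (o, o); (o, j)] = 0.
  have := NX o j; have := TX j o; rewrite !eqxx !mulr1 mulr0 subr0 andbT.
  have [->|jo] := eqVneq j o; last first.
    by rewrite mulr0 subr0 => ->; rewrite add0r.
  rewrite mulr1 => /eqP; rewrite subr_eq0 => /eqP ->; exact: double_eq0.
have a0 i j : k [:: (i, j)] = 0.
  by have := NX i j; rewrite d0 mul0r addr0.
have q0 i j : j != o -> k [:: (o, i); (o, o); (j, o)] = 0.
  move=> jo; have := TX i j; rewrite a0 d0 mul0r subr0 sub0r jo mulr1.
  by move/eqP; rewrite oppr_eq0 => /eqP.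
(* even degree: off the corner entry everything vanishes, and there the unknowns
   k(oo oo) and k(oo oo oo oo) have zero sum and zero difference *)
have p0 i j : (i, j) != (o, o) -> k [:: (o, i); (j, o)] = 0.
  move=> ij; have := TY i j; rewrite ij mulr1.
  have -> : (i == o) && (j == o) = false.
    by apply/negbTE; move: ij; rewrite xpair_eqE.
  by rewrite mulr0 sub0r => /eqP; rewrite oppr_eq0 => /eqP.
have b0' i j : (i, j) != (o, o) -> k [:: (i, o); (o, j)] = 0.
  move=> ij; have := NY i j.
  have -> : (i == o) && (j == o) = false.
    by apply/negbTE; move: ij; rewrite xpair_eqE.
  by rewrite mulr0 addr0.
have z_b : k (nseq 4 (o, o)) = k [:: (o, o); (o, o)].
  have := TY o o; rewrite !eqxx mulr1 mulr0 subr0 (bigD1 o) //= big1.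
    by rewrite addr0 => /eqP; rewrite subr_eq0 => /eqP.
  by move=> i io; rewrite b0' // xpair_eqE (negPf io).
have z0 : k (nseq 4 (o, o)) = 0.
  have := NY o o; rewrite !eqxx mulr1 -z_b big1 => [|[i j] ij].
    by rewrite addr0; exact: double_eq0.
  by rewrite p0 // mul0r.
have b0 i j : k [:: (i, o); (o, j)] = 0.
  have [[-> ->]|] := eqVneq (i, j) (o, o); last exact: b0'.
  by rewrite -z_b.
rewrite /normal_words !mem_cat; split_membership => //=.
- exact: normal_coef1_eq0.
- exact: p0.
- exact: q0.
Qed.

Lemma normal_words_free : h = 0.
Proof.
apply/malgP => w; rewrite mcoeff0.
have [/h_normal|/mcoeff_outdom //] := boolP (w \in msupp h).
by move/normal_coefs_eq0 => <-; congr (h@_ _); apply: val_inj.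
Qed.

End Independence.

(** * Bases of vector spaces *)

Section Bases.
Variables (F : fieldType) (V : lmodType F).

(** Passes from coefficients indexed by labels to coefficients indexed by
    positions in the list. *)
Lemma is_basis_map (T : eqType) (x0 : T) (g : T -> V) (W : seq T) : uniq W ->
  (forall c : T -> F,
     \sum_(w <- W) c w *: g w = 0 -> {in W, forall w, c w = 0}) ->
  (forall v, exists c : T -> F, v = \sum_(w <- W) c w *: g w) ->
  is_basis (map g W).
Proof.
move=> uW free span.
have sumE (c : T -> F) : \sum_(w <- W) c w *: g w =
    \sum_(i < size (map g W)) c (nth x0 W i) *: (map g W)`_i.
  rewrite (big_nth x0) size_map big_mkord; apply: eq_bigr => i _.
  by rewrite (nth_map x0).
split=> [c c0 i|v].
  pose c' w := if insub (index w W) is Some j then c j else 0.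
  have c'E (j : 'I_(size (map g W))) : c' (nth x0 W j) = c j.
    have jW : (j < size W)%N by rewrite -(size_map g).
    by rewrite /c' index_uniq // valK.
  rewrite -c'E; apply: free; last by rewrite mem_nth // -(size_map g).
  by rewrite sumE -[RHS]c0; apply: eq_bigr => j _; rewrite c'E.
have [c ->] := span v; exists (fun i => c (nth x0 W i)); exact: sumE.
Qed.

Lemma is_basis_finite_dimensional (s : seq V) :
  is_basis s -> finite_dimensional V.
Proof.
move=> [free /choice [c cE]]; exists (size s).
have cU v (d : 'I_(size s) -> F) :
    v = \sum_(i < size s) d i *: s`_i -> c v =1 d.
  move=> vE i; apply/eqP; rewrite -subr_eq0; apply/eqP.
  apply: (free (fun i => c v i - d i)).
  under eq_bigr => j _ do rewrite scalerBl.
  by rewrite sumrB -cE -vE subrr.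
constructor; exists (fun v => \row_i c v i).
  move=> a u v; apply/rowP => i; rewrite !mxE.
  apply: (cU _ (fun i => a * c u i + c v i)).
  rewrite [u in LHS]cE [v in LHS]cE scaler_sumr -big_split /=.
  by apply: eq_bigr => j _; rewrite scalerDl scalerA.
exists (fun r : 'rV[F]_(size s) => \sum_i r 0 i *: s`_i) => [v|r].
  by rewrite [RHS]cE; apply: eq_bigr => i _; rewrite mxE.
by apply/rowP => i; rewrite mxE; apply: (cU _ (fun i => r 0 i)).
Qed.

End Bases.

(** * The theorem *)

Theorem theorem3p11 (F : closedFieldType) (charF : [pchar F] =i pred0)
    (n : nat) (hn : (2 <= n)%N) :
  groebner_basis (@env_ideal F n) (@frakG F n hn) /\
  (finite_dimensional (envelope F n) /\
   uniq (@frakB F n hn) /\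
   size (@frakB F n hn) = (4 * n ^ 2 + 1)%N /\
   is_basis [seq coset b | b <- @frakB F n hn]).
Proof.
case: n hn => [//|m] hn.
pose N : {pred word m.+1} :=
  [pred w : word m.+1 | (w : seq _) \in normal_words hn].
have G_red w : w \notin N ->
    exists g l, [/\ @frakG F m.+1 hn g, is_LM g l & infix l w].
  exact: reducible_not_normal.
have G_sub := @frakG_env_ideal F m.+1 charF hn.
have N_free (h : free_alg F m.+1) :
    env_ideal h -> {subset msupp h <= N} -> h = 0.
  by move=> hI hN; apply: (normal_words_free charF _ hI) => w /hN.
split; first exact: (normal_words_groebner hn G_sub G_red N_free).
have inj_mono : injective (@mono F m.+1).
  move=> s t st; have : FMonom s \in msupp (mono F t).
    by rewrite -st /mono msuppU1 in_fset1.
  by rewrite /mono msuppU1 in_fset1 => /eqP [].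
have uW := uniq_normal_words hn.
suff B : is_basis [seq coset b | b <- @frakB F m.+1 hn].
  split; first exact: is_basis_finite_dimensional B.
  split; first by rewrite frakB_mono map_inj_uniq.
  by split=> //; rewrite frakB_mono size_map size_normal_words.
rewrite frakB_mono -map_comp; apply: (is_basis_map [::]) => //.
  move=> c c0 w wN.
  pose h : free_alg F m.+1 := \sum_(w <- normal_words hn) c w *: mono F w.
  have hE v : h@_(FMonom v) = \sum_(w <- normal_words hn) c w *+ (w == v).
    rewrite raddf_sum; apply: eq_bigr => u _.
    by rewrite /= mcoeffZ mcoeffU mulr_natr.
  have hw : h@_(FMonom w) = c w.
    rewrite hE (bigD1_seq w) //= eqxx big1 ?addr0 // => v vw.
    by rewrite (negPf vw).
  rewrite -hw (N_free h) ?mcoeff0 //.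
    apply/env_ideal_coset; rewrite raddf_sum -[RHS]c0.
    by apply: eq_bigr => v _; rewrite /= linearZ.
  move=> v; rewrite -mcoeff_neq0 -[v]fmK hE; apply: contraR => vN.
  rewrite big1_seq // => u /andP [_ uN].
  by have [uv|//] := eqVneq; rewrite -uv in vN; rewrite inE uN in vN.
move=> x; have [h hI hN] := exists_normal_form hn G_sub G_red (repr x).
exists (fun w => h@_(FMonom w)).
have -> : x = coset h.
  by rewrite [LHS]coset_surj; apply/eqP; rewrite coset_eq; apply/env_idealP.
rewrite {1}(sum_supp uW hN) raddf_sum.
by apply: eq_bigr => w _; rewrite /= linearZ.
Qed.
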